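(* Let $X$ be an injective object in a Grothendieck category $\mathcal A$. Then the partially ordered set $\mathbf D(X)$ is a complete Boolean lattice. Moreover, there is a canonical lattice isomorphism $$\mathbf D(X)\xrightarrow{\ \sim\ }\mathbf B\bigl(\operatorname{End}(X)/J(\operatorname{End}(X))\bigr).$$
   Context: A full subcategory of $\mathcal A$ is essentially closed if it is closed under arbitrary coproducts, subobjects, and essential extensions. For an object $U\in\mathcal A$, $\langle U\rangle$ denotes the smallest essentially closed subcategory of $\mathcal A$ containing $U$. Let $X$ be an injective object. Two direct summands $U\subseteq X$ and $V\subseteq X$ are essentially equivalent if $\langle U\rangle=\langle V\rangle$. $\mathbf D(X)$ denotes the set of essential equivalence classes of direct summands of $X$, with partial order given by $U\le V$ if $\langle U\rangle\subseteq\langle V\rangle$. For a ring $\Lambda$, $J(\Lambda)$ denotes its Jacobson radical, and $\mathbf B(\Lambda)$ denotes the lattice of central idempotents of $\Lambda$ with operations $x\vee y=x+y-xy$ and $x\wedge y=xy$. *)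

(* Defs.v *)
From HB Require Import structures.
From mathcomp Require Import all_boot all_order all_algebra.
From mathcomp Require Import boolp classical_sets.

Set Implicit Arguments.
Unset Strict Implicit.
Unset Printing Implicit Defensive.

Import Order.TTheory GRing.Theory.

Local Open Scope classical_set_scope.
Local Open Scope ring_scope.
Local Open Scope quotient_scope.

(* One and the same universe bounds the hom-sets and the index sets of
   coproducts and colimits; the collection of objects may be larger. *)
Definition Small := Type.

Record category_on (ob : Type) (mor : ob -> ob -> Small) := CategoryOn {
  idm : forall A, mor A A;
  comp : forall A B C, mor B C -> mor A B -> mor A C;
  compA : forall A B C D (h : mor C D) (g : mor B C) (f : mor A B),
    comp h (comp g f) = comp (comp h g) f;
  comp1m : forall A B (f : mor A B), comp (idm B) f = f;
  compm1 : forall A B (f : mor A B), comp f (idm A) = f }.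

Record small_category := SmallCategory {
  sob : Small;
  smor : sob -> sob -> Small;
  small_category_on :> category_on smor }.
Coercion sob_type (J : small_category) : Type := sob J.

Record preadditive_category := PreadditiveCategory {
  ob :> Type;
  mor : ob -> ob -> Small;
  preadditive_category_on : category_on mor;
  hom_zero : forall A B, mor A B;
  hom_opp : forall A B, mor A B -> mor A B;
  hom_add : forall A B, mor A B -> mor A B -> mor A B;
  hom_addA : forall A B, associative (@hom_add A B);
  hom_addC : forall A B, commutative (@hom_add A B);
  hom_add0 : forall A B, left_id (hom_zero A B) (@hom_add A B);
  hom_addN : forall A B,
    left_inverse (hom_zero A B) (@hom_opp A B) (@hom_add A B);
  hom_compDl : forall A B C (g g' : mor B C) (f : mor A B),
    comp preadditive_category_on (hom_add g g') f =
    hom_add (comp preadditive_category_on g f)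
            (comp preadditive_category_on g' f);
  hom_compDr : forall A B C (g : mor B C) (f f' : mor A B),
    comp preadditive_category_on g (hom_add f f') =
    hom_add (comp preadditive_category_on g f)
            (comp preadditive_category_on g f') }.

Notation "g ∘ f" := (comp (preadditive_category_on _) g f)
  (at level 40, left associativity).
Notation "'id_ A" := (idm (preadditive_category_on _) A)
  (at level 8, A at level 2, format "''id_' A").

HB.instance Definition _ (C : preadditive_category) (A B : C) :=
  gen_eqMixin (mor A B).
HB.instance Definition _ (C : preadditive_category) (A B : C) :=
  gen_choiceMixin (mor A B).
HB.instance Definition _ (C : preadditive_category) (A B : C) :=
  GRing.isZmodule.Build (mor A B) (@hom_addA C A B) (@hom_addC C A B)
    (@hom_add0 C A B) (@hom_addN C A B).

Section Morphisms.
Variable C : preadditive_category.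

Definition mono (A B : C) (f : mor A B) : Prop :=
  forall Y (g h : mor Y A), f ∘ g = f ∘ h -> g = h.

Definition epi (A B : C) (f : mor A B) : Prop :=
  forall Y (g h : mor B Y), g ∘ f = h ∘ f -> g = h.

Definition is_zero_object (Z : C) : Prop :=
  forall A, (forall f : mor A Z, f = 0) /\ (forall f : mor Z A, f = 0).

Definition is_product (A B P : C) (p : mor P A) (q : mor P B) : Prop :=
  forall Y (f : mor Y A) (g : mor Y B),
    exists! h : mor Y P, p ∘ h = f /\ q ∘ h = g.

Definition is_kernel (A B K : C) (f : mor A B) (k : mor K A) : Prop :=
  f ∘ k = 0 /\
  forall Y (g : mor Y A), f ∘ g = 0 -> exists! h : mor Y K, k ∘ h = g.

Definition is_cokernel (A B Q : C) (f : mor A B) (q : mor B Q) : Prop :=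
  q ∘ f = 0 /\
  forall Y (g : mor B Y), g ∘ f = 0 -> exists! h : mor Q Y, h ∘ q = g.

Definition is_coproduct (I : Small) (F : I -> C) (S : C)
    (inj : forall i, mor (F i) S) : Prop :=
  forall Y (g : forall i, mor (F i) Y),
    exists! h : mor S Y, forall i, h ∘ inj i = g i.

(* 0 -> A -> B -> Q -> 0 *)
Definition short_exact (A B Q : C) (f : mor A B) (g : mor B Q) : Prop :=
  is_kernel g f /\ is_cokernel f g.

Definition is_generator (G : C) : Prop :=
  forall A B (f g : mor A B), (forall h : mor G A, f ∘ h = g ∘ h) -> f = g.

Definition injective_object (X : C) : Prop :=
  forall A B (m : mor A B) (f : mor A X),
    mono m -> exists g : mor B X, g ∘ m = f.

Definition essential_mono (A B : C) (m : mor A B) : Prop :=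
  mono m /\ forall Y (g : mor B Y), mono (g ∘ m) -> mono g.

End Morphisms.

Definition filtered (J : small_category) : Prop :=
  [/\ inhabited J,
      forall i j : J, exists k : J, inhabited (smor i k) /\ inhabited (smor j k)
    & forall (i j : J) (u v : smor i j), exists (k : J) (w : smor j k),
        comp J w u = comp J w v].

Record diagram (J : small_category) (C : preadditive_category) := Diagram {
  diag_ob :> J -> C;
  diag_map : forall i j, smor i j -> mor (diag_ob i) (diag_ob j);
  diag_id : forall i, diag_map (idm J i) = 'id_(diag_ob i);
  diag_comp : forall i j k (v : smor j k) (u : smor i j),
    diag_map (comp J v u) = diag_map v ∘ diag_map u }.

Section Colimits.
Variables (J : small_category) (C : preadditive_category).

Definition natural (F G : diagram J C) (a : forall i, mor (F i) (G i)) : Prop :=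
  forall i j (u : smor i j), a j ∘ diag_map F u = diag_map G u ∘ a i.

Definition is_cocone (F : diagram J C) (L : C) (inj : forall i, mor (F i) L) :=
  forall i j (u : smor i j), inj j ∘ diag_map F u = inj i.

Definition is_colimit (F : diagram J C) (L : C) (inj : forall i, mor (F i) L)
    : Prop :=
  is_cocone inj /\
  forall Y (g : forall i, mor (F i) Y), is_cocone g ->
    exists! h : mor L Y, forall i, h ∘ inj i = g i.

(* Existence of the colimits is not part of this property: in a Grothendieck
   category it follows from coproducts and cokernels. *)
Definition exact_colimits : Prop :=
  forall (F G H : diagram J C)
    (a : forall i, mor (F i) (G i)) (b : forall i, mor (G i) (H i))
    (LF LG LH : C) (iF : forall i, mor (F i) LF) (iG : forall i, mor (G i) LG)
    (iH : forall i, mor (H i) LH) (f : mor LF LG) (g : mor LG LH),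
    natural a -> natural b -> (forall i, short_exact (a i) (b i)) ->
    is_colimit iF -> is_colimit iG -> is_colimit iH ->
    (forall i, f ∘ iF i = iG i ∘ a i) -> (forall i, g ∘ iG i = iH i ∘ b i) ->
    short_exact f g.

End Colimits.

Record abelian (C : preadditive_category) : Prop := Abelian {
  abelian_zero : exists Z : C, is_zero_object Z;
  abelian_product : forall A B : C,
    exists (P : C) (p : mor P A) (q : mor P B), is_product p q;
  abelian_kernel : forall (A B : C) (f : mor A B),
    exists (K : C) (k : mor K A), is_kernel f k;
  abelian_cokernel : forall (A B : C) (f : mor A B),
    exists (Q : C) (q : mor B Q), is_cokernel f q;
  abelian_mono : forall (A B : C) (m : mor A B), mono m ->
    exists (Q : C) (f : mor B Q), is_kernel f m;
  abelian_epi : forall (A B : C) (e : mor A B), epi e ->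
    exists (K : C) (f : mor K A), is_cokernel f e }.

Record grothendieck (C : preadditive_category) : Prop := Grothendieck {
  grothendieck_abelian : abelian C;
  grothendieck_coproduct : forall (I : Small) (F : I -> C),
    exists (S : C) (inj : forall i, mor (F i) S), is_coproduct inj;
  grothendieck_exact : forall J : small_category,
    filtered J -> exact_colimits J C;
  grothendieck_generator : exists G : C, is_generator G }.

(* A full subcategory is given by its set of objects. Each closure condition
   refers to objects up to isomorphism, so these subcategories are replete. *)
Record essentially_closed (C : preadditive_category) (S : set C) : Prop :=
  EssentiallyClosed {
    closed_coproduct : forall (I : Small) (F : I -> C) (P : C)
      (inj : forall i, mor (F i) P),
      is_coproduct inj -> (forall i, S (F i)) -> S P;
    closed_subobject : forall (A B : C) (m : mor A B), mono m -> S B -> S A;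
    closed_essential : forall (A B : C) (m : mor A B),
      essential_mono m -> S A -> S B }.

Definition ess_gen (C : preadditive_category) (U : C) : set C :=
  smallest (@essentially_closed C) [set U].

Record summand (C : preadditive_category) (X : C) := Summand {
  summand_ob :> C;
  summand_inc : mor summand_ob X;
  summand_split : exists p : mor X summand_ob, p ∘ summand_inc = 'id_summand_ob }.

HB.instance Definition _ (C : preadditive_category) (X : C) :=
  gen_eqMixin (summand X).
HB.instance Definition _ (C : preadditive_category) (X : C) :=
  gen_choiceMixin (summand X).

Section EssentialEquivalence.
Variables (C : preadditive_category) (X : C).

Definition ess_equiv (U V : summand X) : bool := `[< ess_gen U = ess_gen V >].

Lemma ess_equiv_refl : reflexive ess_equiv.
Proof. by move=> U; apply/asboolP. Qed.

Lemma ess_equiv_sym : symmetric ess_equiv.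
Proof. by move=> U V; apply/asboolP/asboolP => ->. Qed.

Lemma ess_equiv_trans : transitive ess_equiv.
Proof. by move=> V U W /asboolP UV /asboolP VW; apply/asboolP; rewrite UV. Qed.

Canonical ess_equiv_equiv :=
  EquivRel ess_equiv ess_equiv_refl ess_equiv_sym ess_equiv_trans.

Definition Dlat := {eq_quot ess_equiv}.
HB.instance Definition _ := Choice.on Dlat.
HB.instance Definition _ := EqQuotient.on Dlat.

Definition Dclass (U : summand X) : Dlat := \pi_Dlat U.

Definition Dle (x y : Dlat) : bool := `[< ess_gen (repr x) `<=` ess_gen (repr y) >].

Lemma ess_gen_repr (U : summand X) : ess_gen (repr (Dclass U)) = ess_gen U.
Proof.
have : (repr (Dclass U) == U %[mod Dlat]) by rewrite reprK.
by rewrite eqmodE => /asboolP.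
Qed.

Lemma Dle_refl : reflexive Dle.
Proof. by move=> x; apply/asboolP. Qed.

Lemma Dle_anti : antisymmetric Dle.
Proof.
move=> x y /andP[/asboolP xy /asboolP yx].
rewrite -[x]reprK -[y]reprK; apply/eqP; rewrite eqmodE; apply/asboolP.
exact/seteqP.
Qed.

Lemma Dle_trans : transitive Dle.
Proof.
move=> y x z /asboolP xy /asboolP yz; apply/asboolP.
exact: subset_trans xy yz.
Qed.

Fact Dlat_display : Order.disp_t. Proof. exact: Order.Disp tt tt. Qed.

HB.instance Definition _ :=
  Order.Le_isPOrder.Build Dlat_display Dlat Dle_refl Dle_anti Dle_trans.

Lemma Dclass_le (U V : summand X) :
  (Dclass U <= Dclass V)%O = `[< ess_gen U `<=` ess_gen V >].
Proof. by rewrite -(ess_gen_repr U) -(ess_gen_repr V). Qed.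

End EssentialEquivalence.

Record complete_boolean_lattice d (T : porderType d) := CompleteBooleanLattice {
  cb_meet : T -> T -> T;
  cb_join : T -> T -> T;
  cb_bot : T;
  cb_top : T;
  cb_compl : T -> T;
  cb_meetP : forall x y z, (z <= cb_meet x y)%O = (z <= x)%O && (z <= y)%O;
  cb_joinP : forall x y z, (cb_join x y <= z)%O = (x <= z)%O && (y <= z)%O;
  cb_botP : forall x, (cb_bot <= x)%O;
  cb_topP : forall x, (x <= cb_top)%O;
  cb_distr : forall x y z,
    cb_meet x (cb_join y z) = cb_join (cb_meet x y) (cb_meet x z);
  cb_meet_compl : forall x, cb_meet x (cb_compl x) = cb_bot;
  cb_join_compl : forall x, cb_join x (cb_compl x) = cb_top;
  cb_sup : forall A : set T, supremums A !=set0;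
  cb_inf : forall A : set T, infimums A !=set0 }.

Definition End (C : preadditive_category) (X : C) := mor X X.

Section EndRing.
Variables (C : preadditive_category) (X : C).

HB.instance Definition _ := GRing.Zmodule.on (End X).

Definition End_mul (g f : End X) : End X := g ∘ f.

Lemma End_mulA : associative End_mul.
Proof. by move=> h g f; apply: compA. Qed.
Lemma End_mul1r : left_id 'id_X End_mul.
Proof. by move=> f; apply: comp1m. Qed.
Lemma End_mulr1 : right_id 'id_X End_mul.
Proof. by move=> f; apply: compm1. Qed.
Lemma End_mulDl : left_distributive End_mul +%R.
Proof. by move=> g g' f; apply: hom_compDl. Qed.
Lemma End_mulDr : right_distributive End_mul +%R.
Proof. by move=> g f f'; apply: hom_compDr. Qed.

HB.instance Definition _ := GRing.Zmodule_isPzRing.Build (End X)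
  End_mulA End_mul1r End_mulr1 End_mulDl End_mulDr.

End EndRing.

Section Jacobson.
Variable R : pzRingType.

Record left_ideal (L : set R) : Prop := LeftIdeal {
  left_ideal0 : L 0;
  left_idealB : forall x y, L x -> L y -> L (x - y);
  left_idealM : forall a x, L x -> L (a * x) }.

Definition maximal_left_ideal (L : set R) : Prop :=
  [/\ left_ideal L, L <> setT
    & forall M, left_ideal M -> L `<=` M -> M = L \/ M = setT].

Definition jacobson : {pred R} :=
  [pred x | `[< (\bigcap_(L in maximal_left_ideal) L) x >]].

Lemma jacobsonP x :
  reflect (forall L, maximal_left_ideal L -> L x) (x \in jacobson).
Proof. exact: asboolP. Qed.

Lemma jacobson_zmod_closed : zmod_closed jacobson.
Proof.
split; first by apply/jacobsonP => L [[]].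
move=> x y /jacobsonP Jx /jacobsonP Jy; apply/jacobsonP => L mL.
by case: (mL) => lL _ _; apply: left_idealB; [|apply: Jx|apply: Jy].
Qed.

HB.instance Definition _ := GRing.isZmodClosed.Build R jacobson jacobson_zmod_closed.

Lemma jacobsonMl a x : x \in jacobson -> a * x \in jacobson.
Proof.
move=> /jacobsonP Jx; apply/jacobsonP => L mL.
by case: (mL) => lL _ _; apply: left_idealM => //; apply: Jx.
Qed.

(* If L is maximal, then {y | y * a \in L} is R or a maximal left ideal. *)
Lemma jacobsonMr a x : x \in jacobson -> x * a \in jacobson.
Proof.
move=> /jacobsonP Jx; apply/jacobsonP => L mL.
case: (mL) => lL LT Lmax; have [L0 LB LM] := lL.
have LD y z : L y -> L z -> L (y + z).
  by move=> Ly Lz; rewrite -[z]opprK -[- z]add0r; do 2?apply: (LB) => //.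
have [La|nLa] := pselect (L a); first exact: LM.
suff : maximal_left_ideal [set y | L (y * a)] by move/Jx.
split.
- split=> [|y z /= Ly Lz|b y /= Ly]; rewrite /= ?mul0r ?mulrBl -?mulrA //.
    exact: LB.
  exact: LM.
- by move=> /seteqP[_ /(_ 1 I)] /=; rewrite mul1r.
- move=> M [M0 MB MM] sLM.
  pose N := [set z | exists l m, [/\ L l, M m & z = l + m * a]].
  have lN : left_ideal N.
    split.
    + by exists 0, 0; rewrite mul0r addr0.
    + move=> _ _ [l [m [Ll Mm ->]]] [l' [m' [Ll' Mm' ->]]].
      exists (l - l'), (m - m'); split; [exact: LB|exact: MB|].
      by rewrite mulrBl opprD addrACA.
    + move=> b _ [l [m [Ll Mm ->]]]; exists (b * l), (b * m).
      by split; [exact: LM|exact: MM|rewrite mulrDr mulrA].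
  have sLN : L `<=` N by move=> l Ll; exists l, 0; rewrite mul0r addr0.
  have MN y : M y -> N (y * a) by move=> My; exists 0, y; rewrite add0r.
  have [NL|NT] := Lmax N lN sLN.
    left; apply/seteqP; split=> // y My /=.
    by rewrite -NL; apply: MN.
  right; apply/seteqP; split=> // y _.
  have [l [m [Ll Mm e]]] : N (y * a) by rewrite NT.
  have -> : y = (y - m) - (- m) by rewrite opprK subrK.
  apply: (MB); last by rewrite -[- m]add0r; apply: MB.
  by apply: sLM; rewrite /= mulrBl e addrK.
Qed.

Definition mod_jacobson := Quotient.quot jacobson.
HB.instance Definition _ := GRing.Zmodule.on mod_jacobson.

Definition modJ (x : R) : mod_jacobson := \pi_(Quotient.quot jacobson) x.

Definition modJ_mul (x y : mod_jacobson) : mod_jacobson :=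
  modJ (repr x * repr y).

Lemma modJ_repr x : modJ (repr x) = x.
Proof. exact: reprK. Qed.

Lemma modJ_eq x y : (modJ x == modJ y) = (x - y \in jacobson).
Proof. by rewrite Quotient.idealrBE. Qed.

Lemma modJD x y : modJ (x + y) = modJ x + modJ y.
Proof. exact: Quotient.pi_add. Qed.

Lemma modJM x y : modJ_mul (modJ x) (modJ y) = modJ (x * y).
Proof.
apply/eqP; rewrite modJ_eq; set x' := repr _; set y' := repr _.
have -> : x' * y' - x * y = x' * (y' - y) + (x' - x) * y.
  by rewrite mulrBr mulrBl addrA subrK.
by apply: rpredD; [apply: jacobsonMl|apply: jacobsonMr];
  rewrite -modJ_eq modJ_repr.
Qed.

Lemma modJ_mulA : associative modJ_mul.
Proof.
by move=> x y z; rewrite -[x]modJ_repr -[y]modJ_repr -[z]modJ_repr !modJM mulrA.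
Qed.
Lemma modJ_mul1r : left_id (modJ 1) modJ_mul.
Proof. by move=> x; rewrite -[x]modJ_repr !modJM mul1r. Qed.
Lemma modJ_mulr1 : right_id (modJ 1) modJ_mul.
Proof. by move=> x; rewrite -[x]modJ_repr !modJM mulr1. Qed.
Lemma modJ_mulDl : left_distributive modJ_mul +%R.
Proof.
move=> x y z; rewrite -[x]modJ_repr -[y]modJ_repr -[z]modJ_repr.
by rewrite -modJD !modJM -modJD mulrDl.
Qed.
Lemma modJ_mulDr : right_distributive modJ_mul +%R.
Proof.
move=> x y z; rewrite -[x]modJ_repr -[y]modJ_repr -[z]modJ_repr.
by rewrite -modJD !modJM -modJD mulrDr.
Qed.

HB.instance Definition _ := GRing.Zmodule_isPzRing.Build mod_jacobson
  modJ_mulA modJ_mul1r modJ_mulr1 modJ_mulDl modJ_mulDr.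

Lemma modJ_is_zmod_morphism : zmod_morphism modJ.
Proof.
move=> x y; apply: (addIr (modJ y)); rewrite -modJD !subrK //.
Qed.
Lemma modJ_is_monoid_morphism : monoid_morphism modJ.
Proof. by split=> // x y; rewrite -modJM. Qed.

HB.instance Definition _ :=
  GRing.isZmodMorphism.Build R mod_jacobson modJ modJ_is_zmod_morphism.
HB.instance Definition _ :=
  GRing.isMonoidMorphism.Build R mod_jacobson modJ modJ_is_monoid_morphism.

End Jacobson.

Section CentralIdempotents.
Variable R : pzRingType.

Definition central_idempotent : pred R :=
  fun x => (x * x == x) && `[< forall y, GRing.comm x y >].

Record Blat := CentralIdempotent {
  Bval : R;
  BvalP : central_idempotent Bval }.

HB.instance Definition _ := [isSub for Bval].
HB.instance Definition _ := [Choice of Blat by <:].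

Implicit Types x y z : Blat.

Lemma Bval_idem x : Bval x * Bval x = Bval x.
Proof. by case: x => x /= /andP[/eqP]. Qed.

Lemma Bval_comm x (a : R) : Bval x * a = a * Bval x.
Proof. by case: x => x /= /andP[_ /asboolP/(_ a)]. Qed.

Lemma Bmeet_subproof x y : central_idempotent (Bval x * Bval y).
Proof.
apply/andP; split.
  by rewrite mulrA -(mulrA (Bval x)) (Bval_comm y) mulrA Bval_idem -mulrA Bval_idem.
apply/asboolP => a; rewrite /GRing.comm -mulrA (Bval_comm y) mulrA (Bval_comm x).
by rewrite mulrA.
Qed.
Definition Bmeet x y := CentralIdempotent (Bmeet_subproof x y).

Lemma Bcompl_subproof x : central_idempotent (1 - Bval x).
Proof.
apply/andP; split.
  by rewrite mulrBr mulr1 mulrBl mul1r Bval_idem subrr subr0.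
by apply/asboolP => a; rewrite /GRing.comm mulrBl mulrBr mulr1 mul1r Bval_comm.
Qed.
Definition Bcompl x := CentralIdempotent (Bcompl_subproof x).

Lemma Bval_joinE x y :
  Bval x + Bval y - Bval x * Bval y =
  Bval (Bcompl (Bmeet (Bcompl x) (Bcompl y))).
Proof.
rewrite /= mulrBr mulr1 mulrBl mul1r.
by rewrite !opprB [RHS]addrC -[RHS]addrA subrK [RHS]addrC addrA.
Qed.

Lemma Bjoin_subproof x y : central_idempotent (Bval x + Bval y - Bval x * Bval y).
Proof. by rewrite Bval_joinE; apply: BvalP. Qed.
Definition Bjoin x y := CentralIdempotent (Bjoin_subproof x y).

Lemma BjoinE x y : Bjoin x y = Bcompl (Bmeet (Bcompl x) (Bcompl y)).
Proof. by apply: val_inj; apply: Bval_joinE. Qed.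

Lemma BcomplK : involutive Bcompl.
Proof. by move=> x; apply: val_inj => /=; rewrite opprB addrC subrK. Qed.

Lemma BmeetC : commutative Bmeet.
Proof. by move=> x y; apply: val_inj => /=; rewrite Bval_comm. Qed.
Lemma BmeetA : associative Bmeet.
Proof. by move=> x y z; apply: val_inj => /=; rewrite mulrA. Qed.
Lemma Bmeetxx : idempotent_op Bmeet.
Proof. by move=> x; apply: val_inj => /=; rewrite Bval_idem. Qed.
Lemma BjoinC : commutative Bjoin.
Proof. by move=> x y; rewrite !BjoinE BmeetC. Qed.
Lemma BjoinA : associative Bjoin.
Proof. by move=> x y z; rewrite !BjoinE !BcomplK BmeetA. Qed.
Lemma BjoinKI y x : Bmeet x (Bjoin x y) = x.
Proof.
apply: val_inj => /=.
by rewrite mulrBr mulrDr mulrA Bval_idem addrK.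
Qed.
Lemma BmeetKU y x : Bjoin x (Bmeet x y) = x.
Proof. by apply: val_inj => /=; rewrite mulrA Bval_idem addrK. Qed.
Lemma BmeetUl : left_distributive Bmeet Bjoin.
Proof.
move=> x y z; apply: val_inj => /=; rewrite mulrBl mulrDl; congr (_ - _).
by rewrite -[in RHS]mulrA (mulrA (Bval z)) (Bval_comm z) -!mulrA Bval_idem.
Qed.

Fact Blat_display : Order.disp_t. Proof. exact: Order.Disp tt tt. Qed.

HB.instance Definition _ :=
  Order.isMeetJoinDistrLattice.Build Blat_display Blat
    (fun _ _ => erefl) (fun _ _ => erefl)
    BmeetC BjoinC BmeetA BjoinA BjoinKI BmeetKU BmeetUl Bmeetxx.

Lemma Bval_meet x y : Bval (x `&` y)%O = Bval x * Bval y.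
Proof. by []. Qed.
Lemma Bval_join x y : Bval (x `|` y)%O = Bval x + Bval y - Bval x * Bval y.
Proof. by []. Qed.
Lemma Ble_def x y : (x <= y)%O = (Bval x * Bval y == Bval x).
Proof. by []. Qed.

End CentralIdempotents.

(* Main.v *)
Require Import Defs.
From HB Require Import structures.
From mathcomp Require Import all_boot all_order all_algebra.
From mathcomp Require Import boolp classical_sets.

Set Implicit Arguments.
Unset Strict Implicit.
Unset Printing Implicit Defensive.

Import Order.TTheory GRing.Theory.

Local Open Scope ring_scope.

(** Call an object saturated with respect to a class G closed under subobjects if
    each of its nonzero subobjects contains a nonzero member of G. In a
    Grothendieck category the saturated objects form the smallest essentially
    closed subcategory containing G ([saturation_closed], [saturation_least]): a
    nonzero subobject of a coproduct contains a nonzero subobject that embeds into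
    a summand, and a maximal direct sum of subobjects belonging to G is essential
    in a saturated object. So the order on summands is read off from subobjects:
    U <= V if and only if every nonzero subobject of U contains a nonzero one that
    embeds into V ([ess_gen_sub]).

    If X is injective, then G splits it as A ⊕ A', where A is saturated and A' has
    no nonzero subobject in G ([injective_splitting]): a maximal saturated subobject
    has no proper essential extension inside X, hence is a retract. Suprema in D(X)
    come from taking for G the subobjects of all members of a family
    ([Dlat_supremum]).

    The radical of End(X) consists of the endomorphisms with essential kernel
    ([jacobson_negligible]). A and A' have no nonzero subobject in common, so that
    all morphisms between them have essential kernel, and the projection onto A
    becomes central modulo the radical ([saturated_part_central]). If G is the class
    of subobjects of a summand U, this central idempotent is the least one that
    fixes the class of the projection onto U; call it the central support of U. It
    fixes the class of the projection onto V if and only if V <= U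
    ([central_supportP]), so U -> central support of U is an order embedding of
    D(X). Every central idempotent arises: lift it to h and split X along the class
    of objects having an embedding y into X with h y = y
    ([central_idempotent_lift]). The Boolean operations are then transported along
    the order isomorphism.

    All steps using exactness of filtered colimits go through one consequence of
    it: a morphism on a directed union is injective if it is injective on each
    member ([directed_union]). *)

(** * Kernels and monomorphisms *)

Section Preadditive.
Variable C : preadditive_category.
Implicit Types A B D : C.

Lemma compmA A B D E (h : mor D E) (g : mor B D) (f : mor A B) :
  h ∘ (g ∘ f) = h ∘ g ∘ f.
Proof. exact: Defs.compA. Qed.

Lemma compm_id A B (f : mor A B) : f ∘ 'id_A = f.
Proof. exact: compm1. Qed.

Lemma comp_idm A B (f : mor A B) : 'id_B ∘ f = f.
Proof. exact: comp1m. Qed.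

Lemma compDl A B D (g g' : mor B D) (f : mor A B) :
  (g + g') ∘ f = g ∘ f + g' ∘ f.
Proof. exact: hom_compDl. Qed.

Lemma compDr A B D (g : mor B D) (f f' : mor A B) :
  g ∘ (f + f') = g ∘ f + g ∘ f'.
Proof. exact: hom_compDr. Qed.

Lemma comp0m A B D (f : mor A B) : (0 : mor B D) ∘ f = 0.
Proof. by apply: (addIr ((0 : mor B D) ∘ f)); rewrite -compDl !add0r. Qed.

Lemma compm0 A B D (g : mor B D) : g ∘ (0 : mor A B) = 0.
Proof. by apply: (addIr (g ∘ (0 : mor A B))); rewrite -compDr !add0r. Qed.

Lemma compNl A B D (g : mor B D) (f : mor A B) : (- g) ∘ f = - (g ∘ f).
Proof. by apply: (addIr (g ∘ f)); rewrite -compDl !addNr comp0m. Qed.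

Lemma compNr A B D (g : mor B D) (f : mor A B) : g ∘ (- f) = - (g ∘ f).
Proof. by apply: (addIr (g ∘ f)); rewrite -compDr !addNr compm0. Qed.

Lemma compBl A B D (g g' : mor B D) (f : mor A B) :
  (g - g') ∘ f = g ∘ f - g' ∘ f.
Proof. by rewrite compDl compNl. Qed.

Lemma compBr A B D (g : mor B D) (f f' : mor A B) :
  g ∘ (f - f') = g ∘ f - g ∘ f'.
Proof. by rewrite compDr compNr. Qed.

Lemma monoP A B (f : mor A B) :
  mono f <-> forall Y (g : mor Y A), f ∘ g = 0 -> g = 0.
Proof.
split=> [mf Y g fg0|fP Y g h fgh]; first by apply: mf; rewrite fg0 compm0.
by apply/eqP; rewrite -subr_eq0; apply/eqP/fP; rewrite compBr fgh subrr.
Qed.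

Lemma mono_comp A B D (g : mor B D) (f : mor A B) :
  mono g -> mono f -> mono (g ∘ f).
Proof. by move=> mg mf Y u v; rewrite -!compmA => /mg/mf. Qed.

Lemma mono_of_comp A B D (g : mor B D) (f : mor A B) : mono (g ∘ f) -> mono f.
Proof. by move=> mgf Y u v fuv; apply: mgf; rewrite -!compmA fuv. Qed.

Lemma mono_id A : mono 'id_A.
Proof. by move=> Y u v; rewrite !comp1m. Qed.

Lemma split_mono A B (g : mor B A) (f : mor A B) : g ∘ f = 'id_A -> mono f.
Proof. by move=> gf; apply: (@mono_of_comp _ _ _ g); rewrite gf; apply: mono_id. Qed.

Lemma kernel_mono A B K (f : mor A B) (k : mor K A) : is_kernel f k -> mono k.
Proof.
move=> [fk0 kP] Y u v kuv.
have /kP[w [_ wU]] : f ∘ (k ∘ u) = 0 by rewrite compmA fk0 comp0m.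
by rewrite -(wU u) // (wU v).
Qed.

Lemma cokernel_epi A B Q (f : mor A B) (q : mor B Q) : is_cokernel f q -> epi q.
Proof.
move=> [qf0 qP] Y u v uqv.
have /qP[w [_ wU]] : (u ∘ q) ∘ f = 0 by rewrite -compmA qf0 compm0.
by rewrite -(wU u) // (wU v).
Qed.

Definition nonzero A : Prop := 'id_A <> 0.

Lemma mono_neq0 A B (f : mor A B) : mono f -> nonzero A -> f <> 0.
Proof. by move=> mf nA f0; apply: nA; apply: mf; rewrite f0 !comp0m. Qed.

End Preadditive.

Section Abelian.
Variable C : preadditive_category.
Hypothesis aC : abelian C.
Implicit Types A B D : C.

(** The elementary substitute for intersecting with a kernel: whatever fails to
    be injective kills a nonzero subobject. *)
Lemma not_mono_kernel A B (f : mor A B) : ~ mono f ->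
  exists (K : C) (k : mor K A), [/\ mono k, nonzero K & f ∘ k = 0].
Proof.
move=> nmf; have [K [k kf]] := abelian_kernel aC f.
exists K, k; split; [exact: kernel_mono kf| |by case: kf].
move=> K0; apply: nmf; apply/monoP => Y g fg0.
have [_ /(_ _ _ fg0)[h [<- _]]] := kf.
by rewrite -[h]comp_idm K0 comp0m compm0.
Qed.

(** In an abelian category a subobject is the kernel of something. Presenting it
    by such a morphism turns a statement about a quotient into one about
    composition. *)
Lemma mono_kernel A B (m : mor A B) : mono m ->
  exists (Q : C) (f : mor B Q), f ∘ m = 0 /\
    forall Y (g : mor Y B), f ∘ g = 0 -> exists h : mor Y A, m ∘ h = g.
Proof.
move=> mm; have [Q [f [fm0 mP]]] := abelian_mono aC mm.
by exists Q, f; split=> // Y g /mP[h [mh _]]; exists h.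
Qed.

Lemma kernel_cokernel A B Q (m : mor A B) (q : mor B Q) :
  mono m -> is_cokernel m q -> is_kernel q m.
Proof.
move=> mm [qm0 qP]; split=> // Y g qg0.
have [Q' [f [fm0 mP]]] := mono_kernel mm.
have [f' [f'q _]] := qP _ _ fm0.
have [|h mh] := mP _ g; first by rewrite -f'q -compmA qg0 compm0.
by exists h; split=> // h' mh'; apply: mm; rewrite mh.
Qed.

(** The injective half of the isomorphism theorem: a morphism factors through
    the quotient by its own kernel as a monomorphism. If m kills w, let e be the
    cokernel of w. Then e ∘ c has the same kernel as c; since an epimorphism is
    the cokernel of its kernel, c factors through e ∘ c. So e is a split
    monomorphism, and w is zero. *)
Lemma mono_of_coimage A B K Q (f : mor A B) (k : mor K A) (c : mor A Q)
    (m : mor Q B) :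
  is_kernel f k -> is_cokernel k c -> m ∘ c = f -> mono m.
Proof.
move=> [fk0 kP] cokc mcf; have epc := cokernel_epi cokc.
apply/monoP => W w mw0.
have [E [e coke]] := abelian_cokernel aC w.
have epec : epi (e ∘ c).
  by move=> Y u v; rewrite !compmA => /epc/(cokernel_epi coke).
have [N [n [ecn0 ecP]]] := abelian_epi aC epec.
case: coke => ew0 /(_ _ _ mw0)[m' [m'e _]].
have [|h [kh _]] := kP _ n.
  by rewrite -mcf -m'e -!compmA (compmA e) ecn0 compm0.
case: cokc => ck0 _.
have [|t [tec _]] := ecP _ c; first by rewrite -kh compmA ck0 comp0m.
have te : t ∘ e = 'id_Q by apply: epc; rewrite -compmA tec comp1m.
by rewrite -[w]comp_idm -te -compmA ew0 compm0.
Qed.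

End Abelian.

(** * Directed unions of subobjects *)

Section Grothendieck.
Variable C : preadditive_category.
Hypothesis hC : grothendieck C.
Let aC := grothendieck_abelian hC.
Implicit Types A B D : C.

(** The usual presentation of a colimit as a quotient of a coproduct. *)
Lemma colimit_exists (J : small_category) (F : diagram J C) :
  exists (L : C) (inj : forall i, mor (F i) L), is_colimit inj.
Proof.
have [S [a aP]] := grothendieck_coproduct hC (fun i : J => F i).
pose I := {i : J & {j : J & smor i j}}.
have [S' [a' a'P]] := grothendieck_coproduct hC (fun p : I => F (tag p)).
have [d [dE _]] := a'P _ (fun p : I =>
  a (tag (tagged p)) ∘ diag_map F (tagged (tagged p)) - a (tag p)).
have [L [q [qd0 qP]]] := abelian_cokernel aC d.
exists L, (fun i => q ∘ a i); split.
  move=> i j u; apply/eqP; rewrite -subr_eq0 -compmA -compBr; apply/eqP.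
  have /= <- := dE (existT _ i (existT _ j u)).
  by rewrite compmA qd0 comp0m.
move=> Y g gco; have [h [hE hU]] := aP _ g.
have [|h' [h'q h'U]] := qP _ h.
  have [z [_ zU]] := a'P Y (fun=> 0).
  rewrite -(zU (h ∘ d)) ?(zU 0) // => [p|p]; first by rewrite comp0m.
  by rewrite -compmA dE compBr compmA !hE gco subrr.
exists h'; split=> [i|k kE]; first by rewrite compmA h'q hE.
apply: h'U; symmetry; apply: hU => i.
by rewrite -compmA kE.
Qed.

(** Exactness of filtered colimits in the form in which it is used: apply it to
    the sequences 0 -> F i -> Z -> Z / F i -> 0, whose colimit is
    0 -> L -> Z -> Z / L. *)
Lemma mono_of_filtered_colimit (J : small_category) (F : diagram J C) (L Z : C)
    (inj : forall i, mor (F i) L) (psi : mor L Z) :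
  filtered J -> is_colimit inj -> (forall i, mono (psi ∘ inj i)) -> mono psi.
Proof.
move=> fJ colL mpsi; have [inj_co injU] := colL.
have inj_epi Y (u v : mor L Y) : (forall i, u ∘ inj i = v ∘ inj i) -> u = v.
  move=> uv; have [|h [_ hU]] := injU _ (fun i => u ∘ inj i).
    by move=> i j w; rewrite -compmA inj_co.
  by rewrite -(hU u) // (hU v).
pose G : diagram J C := @Diagram J C (fun=> Z) (fun _ _ _ => 'id_Z)
  (fun=> erefl) (fun _ _ _ _ _ => esym (comp1m _ _)).
have cokH i : {H : C & {h : mor Z H | is_cokernel (psi ∘ inj i) h}}.
  by have /cid[H /cid[h ?]] := abelian_cokernel aC (psi ∘ inj i); exists H, h.
pose Hob i := projT1 (cokH i).
pose h i : mor Z (Hob i) := sval (projT2 (cokH i)).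
have hP i : is_cokernel (psi ∘ inj i) (h i) := svalP (projT2 (cokH i)).
have hepi i : epi (h i) := cokernel_epi (hP i).
have Hmap i j (u : smor i j) : {m : mor (Hob i) (Hob j) | m ∘ h i = h j}.
  apply: cid; case: (hP i) => _ hiP.
  have [|m [mE _]] := hiP _ (h j); last by exists m.
  rewrite -(inj_co _ _ u) (compmA psi) compmA.
  by case: (hP j) => -> _; rewrite comp0m.
have HmapE i j (u : smor i j) : sval (Hmap i j u) ∘ h i = h j := svalP (Hmap i j u).
have H_id i : sval (Hmap i i (idm J i)) = 'id_(Hob i).
  by apply: hepi; rewrite HmapE comp1m.
have H_comp i j k (v : smor j k) (u : smor i j) :
    sval (Hmap i k (Defs.comp J v u)) = sval (Hmap j k v) ∘ sval (Hmap i j u).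
  by apply: hepi; rewrite -compmA !HmapE.
pose H := Diagram H_id H_comp.
have [Q [g cokg]] := abelian_cokernel aC psi.
have HQ i : {m : mor (Hob i) Q | m ∘ h i = g}.
  apply: cid; case: (hP i) => _ hiP.
  have [|m [mE _]] := hiP _ g; last by exists m.
  by rewrite compmA; case: cokg => -> _; rewrite comp0m.
have HQE i : sval (HQ i) ∘ h i = g := svalP (HQ i).
have [[i0] up _] := fJ.
have colG : @is_colimit J C G Z (fun=> 'id_Z).
  split=> [i j u|Y k kco]; first by rewrite compm1.
  exists (k i0); split=> [i|k' k'E]; last by rewrite -(k'E i0) compm1.
  have [j [[u] [v]]] := up i i0.
  by rewrite compm1 -(kco _ _ u) -(kco _ _ v).
have colH : @is_colimit J C H Q (fun i => sval (HQ i)).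
  split=> [i j u|Y k kco].
    by apply: hepi; rewrite -compmA HmapE !HQE.
  have kh i : k i ∘ h i = k i0 ∘ h i0.
    have [j [[u] [v]]] := up i i0.
    by rewrite -(kco _ _ u) -(kco _ _ v) -!compmA !HmapE.
  have kpsi : (k i0 ∘ h i0) ∘ psi = 0.
    apply: inj_epi => i; rewrite comp0m -(kh i) -!compmA.
    by case: (hP i) => -> _; rewrite compm0.
  case: (cokg) => _ /(_ _ _ kpsi)[m [mE mU]].
  exists m; split=> [i|m' m'E]; first by apply: hepi; rewrite -compmA HQE mE kh.
  by apply: mU; rewrite -(HQE i0) compmA m'E.
have [kpsi _] := @grothendieck_exact _ hC J fJ F G H (fun i => psi ∘ inj i) h
  L Z Q inj (fun=> 'id_Z) (fun i => sval (HQ i)) psi g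
  (fun i j u => etrans (esym (compmA _ _ _))
     (etrans (f_equal _ (inj_co _ _ u)) (esym (comp1m _ _))))
  (fun i j u => etrans (compm1 _ _) (esym (HmapE _ _ u)))
  (fun i => conj (kernel_cokernel aC (mpsi i) (hP i)) (hP i))
  colL colG colH (fun i => esym (comp1m _ _))
  (fun i => etrans (compm1 _ _) (esym (HQE i))).
exact: kernel_mono kpsi.
Qed.

Definition thin_category (T : Small) (r : T -> T -> Prop)
    (r_refl : forall t, r t t)
    (r_trans : forall s t u, r t u -> r s t -> r s u) : small_category :=
  @SmallCategory T r (@CategoryOn T r r_refl r_trans
    (fun _ _ _ _ _ _ _ => Prop_irrelevance _ _)
    (fun _ _ _ => Prop_irrelevance _ _) (fun _ _ _ => Prop_irrelevance _ _)).

(** The union L of a directed family of subobjects of Y. The last clause is the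
    only property of unions that is needed: a morphism on L is injective as soon
    as it is injective on every member of the family. *)
Lemma directed_union (T : Small) (r : T -> T -> Prop) (Y : C) (F : T -> C)
    (phi : forall t, mor (F t) Y) :
  inhabited T -> (forall t, r t t) -> (forall s t u, r t u -> r s t -> r s u) ->
  (forall s t, exists u, r s u /\ r t u) -> (forall t, mono (phi t)) ->
  (forall s t, r s t -> exists h : mor (F s) (F t), phi t ∘ h = phi s) ->
  exists (L : C) (l : mor L Y) (inj : forall t, mor (F t) L),
    [/\ mono l, forall t, l ∘ inj t = phi t
      & forall Z (psi : mor L Z), (forall t, mono (psi ∘ inj t)) -> mono psi].
Proof.
move=> T0 r_refl r_trans dir mphi sub.
pose J := thin_category r_refl r_trans.
pose h s t (rst : r s t) := sval (cid (sub s t rst)).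
have hE s t (rst : r s t) : phi t ∘ h s t rst = phi s := svalP (cid (sub s t rst)).
have h_id t : h t t (r_refl t) = 'id_(F t) by apply: (mphi t); rewrite hE compm1.
have h_comp s t u (v : r t u) (w : r s t) :
    h s u (r_trans _ _ _ v w) = h t u v ∘ h s t w.
  by apply: (mphi u); rewrite compmA !hE.
pose D := @Diagram J C F h h_id h_comp.
have fJ : filtered J.
  split=> // [s t|s t u v].
    by have [w [sw tw]] := dir s t; exists w.
  by exists t, (r_refl t); exact: (@Prop_irrelevance (r s t)).
have [L [inj colL]] := colimit_exists D.
have [_ /(_ Y phi hE)[l [lE _]]] := colL.
exists L, l, inj; split=> // [|Z psi]; last exact: mono_of_filtered_colimit fJ colL.
by apply: (mono_of_filtered_colimit fJ colL) => t; rewrite lE.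
Qed.

End Grothendieck.
(** * Independent families and saturation *)

Section Coproduct.
Variables (C : preadditive_category) (I : Small) (F : I -> C) (S : C).
Variable a : forall i, mor (F i) S.
Hypothesis aP : is_coproduct a.

Lemma coproduct_eq Y (u v : mor S Y) : (forall i, u ∘ a i = v ∘ a i) -> u = v.
Proof.
move=> uv; have [h [_ hU]] := aP (fun i => u ∘ a i).
by rewrite -(hU u) // (hU v).
Qed.

(** A subset K of the index set is represented by the idempotent endomorphism
    of the whole coproduct S whose image is the coproduct over K; all partial
    coproducts thus live inside S. *)
Definition partial_id (K : set I) : mor S S :=
  sval (cid (aP (fun i => if `[< K i >] then a i else 0))).

Lemma partial_idE K i : partial_id K ∘ a i = if `[< K i >] then a i else 0.
Proof. by rewrite /partial_id; case: cid => h /= [hE _]; apply: hE. Qed.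

Lemma partial_id_in (K : set I) i : K i -> partial_id K ∘ a i = a i.
Proof. by move=> Ki; rewrite partial_idE asboolT. Qed.

Lemma partial_id_notin (K : set I) i : ~ K i -> partial_id K ∘ a i = 0.
Proof. by move=> Ki; rewrite partial_idE asboolF. Qed.

Lemma partial_id_sub (K K' : set I) :
  (forall i, K i -> K' i) -> partial_id K' ∘ partial_id K = partial_id K.
Proof.
move=> KK'; apply: coproduct_eq => i; rewrite -compmA.
have [Ki|nKi] := pselect (K i); last by rewrite partial_id_notin // compm0.
by rewrite partial_id_in // partial_id_in //; apply: KK'.
Qed.

Lemma coproduct_proj_exists i : exists pr : mor S (F i),
  pr ∘ a i = 'id_(F i) /\ forall j, j <> i -> pr ∘ a j = 0.
Proof.
pose g j : mor (F j) (F i) :=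
  if pselect (j = i) is left e then
    eq_rect j (fun k => mor (F j) (F k)) 'id_(F j) i e
  else 0.
have [pr [prE _]] := aP g; exists pr; split=> [|j ji]; rewrite prE /g.
  by case: pselect => // e; rewrite (Prop_irrelevance e erefl).
by case: pselect.
Qed.

Definition coproduct_proj i : mor S (F i) := sval (cid (coproduct_proj_exists i)).

Lemma coproduct_proj_id i : coproduct_proj i ∘ a i = 'id_(F i).
Proof. exact: (svalP (cid (coproduct_proj_exists i))).1. Qed.

Lemma coproduct_proj_neq i j : j <> i -> coproduct_proj i ∘ a j = 0.
Proof. exact: (svalP (cid (coproduct_proj_exists i))).2. Qed.

Lemma partial_id_add1 (K : set I) i : ~ K i ->
  partial_id (fun j => K j \/ j = i) = partial_id K + a i ∘ coproduct_proj i.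
Proof.
move=> nKi; apply: coproduct_eq => j; rewrite compDl -compmA.
have [->|ji] := pselect (j = i).
  rewrite coproduct_proj_id compm_id (partial_id_notin nKi) add0r.
  by apply: partial_id_in; right.
rewrite (coproduct_proj_neq ji) compm0 addr0 !partial_idE.
have -> : `[< K j \/ j = i >] = `[< K j >]; last by [].
by apply: asbool_equiv_eq; split=> [[Kj|e]|Kj]; [|case: ji|left].
Qed.

(** The restriction of phi to the partial coproduct over K is injective, that
    is, the morphisms phi ∘ a i with i in K form a direct sum in Y. *)
Definition independent Y (phi : mor S Y) (K : set I) : Prop :=
  forall Z (z : mor Z S), partial_id K ∘ z = z -> phi ∘ z = 0 -> z = 0.

End Coproduct.

Definition generator_points (C : preadditive_category) (P A X : C)
    (a : mor A X) : set (mor P X) :=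
  fun g => exists h : mor P A, a ∘ h = g.
Arguments generator_points {C} P {A X} a.

Section Saturation.
Variable C : preadditive_category.
Hypothesis hC : grothendieck C.
Let aC := grothendieck_abelian hC.
Implicit Types A B D X : C.

Lemma partial_image (I : Small) (F : I -> C) (S : C) (a : forall i, mor (F i) S)
    (aP : is_coproduct a) (K : set I) :
  exists (N : C) (n : mor N S), [/\ mono n, partial_id aP K ∘ n = n
    & forall Z (z : mor Z S), partial_id aP K ∘ z = z ->
        exists h : mor Z N, n ∘ h = z].
Proof.
have [N [n kern]] := abelian_kernel aC ('id_S - partial_id aP K).
exists N, n; split; first exact: kernel_mono kern.
  case: kern => /eqP; rewrite compBl comp_idm subr_eq0 => /eqP nE _.
  by rewrite -nE.
move=> Z z zE; case: kern => _ nP.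
have [|h [nh _]] := nP _ z; last by exists h.
by rewrite compBl comp_idm zE subrr.
Qed.

(** The union of a chain of independent subsets K is independent because the
    partial coproduct over it is the union of those over the K. *)
Lemma independent_bigcup (I : Small) (F : I -> C) (S Y : C)
    (a : forall i, mor (F i) S) (aP : is_coproduct a) (phi : mor S Y)
    (E : set (set I)) :
  (forall K, E K -> independent aP phi K) -> total_on E subset ->
  independent aP phi (\bigcup_(K in E) K).
Proof.
move=> indE totE; set M := bigcup _ _ => Z z zE phiz.
have [[K0 EK0]|E0] := pselect (exists K, E K); last first.
  rewrite -zE; suff -> : partial_id aP M = 0 by rewrite comp0m.
  apply: (coproduct_eq aP) => i; rewrite comp0m partial_id_notin // => -[K EK _].
  by apply: E0; exists K.
pose T := {K : set I | E K}.
have img (t : T) := partial_image aP (sval t).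
pose N t := sval (cid (img t)).
pose n t : mor (N t) S := sval (cid (svalP (cid (img t)))).
have nP t : [/\ mono (n t), partial_id aP (sval t) ∘ n t = n t
    & forall W (w : mor W S), partial_id aP (sval t) ∘ w = w ->
        exists h : mor W (N t), n t ∘ h = w] := svalP (cid (svalP (cid (img t)))).
have lift_n t W (w : mor W S) : partial_id aP (sval t) ∘ w = w ->
    exists h : mor W (N t), n t ∘ h = w by case: (nP t) => _ _; apply.
pose r (s t : T) := (sval s `<=` sval t)%classic.
have [||s t|t|s t rst|L [l [inj [ml lE Lmono]]]] :=
    @directed_union C hC T r S N n (inhabits (exist _ K0 EK0)).
- by move=> t i.
- by move=> s t u tu st i /st/tu.
- have [st|ts] := totE _ _ (svalP s) (svalP t).
    by exists t; split=> // i.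
  by exists s; split=> // i.
- by case: (nP t).
- apply: lift_n; case: (nP s) => _ nE _.
  by rewrite -nE compmA partial_id_sub.
have mphil : mono (phi ∘ l).
  apply: Lmono => t; rewrite -compmA lE; apply/monoP => W w.
  case: (nP t) => mn nE _; rewrite -compmA => /(indE _ (svalP t)) nw0.
  by apply: mn; rewrite nw0 ?compm0 // compmA nE.
(* L receives all the summands indexed by M, hence contains the partial coproduct
   over M. *)
have Lsum i : exists g : mor (F i) L, l ∘ g = partial_id aP M ∘ a i.
  have [[K EK Ki]|nMi] := pselect (M i); last first.
    by exists 0; rewrite compm0 partial_id_notin.
  pose t : T := exist _ K EK.
  have [|h nh] := lift_n t _ (a i); first exact: partial_id_in.
  by exists (inj t ∘ h); rewrite compmA lE nh partial_id_in //; exists K.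
have [s [sE _]] := aP L (fun i => sval (cid (Lsum i))).
have ls : l ∘ s = partial_id aP M.
  by apply: (coproduct_eq aP) => i; rewrite -compmA sE (svalP (cid (Lsum i))).
rewrite -zE -ls -compmA.
have -> : s ∘ z = 0; last by rewrite compm0.
by move/monoP: mphil; apply; rewrite -compmA (compmA l) ls zE.
Qed.

(** Maximality of K is exploited as follows: for i outside K some nonzero
    subobject of the partial coproduct over K and i is killed by phi, and it
    embeds into F i since it meets the partial coproduct over K trivially. *)
Lemma maximal_independent (I : Small) (F : I -> C) (S Y : C)
    (a : forall i, mor (F i) S) (aP : is_coproduct a) (phi : mor S Y) :
  exists K : set I, independent aP phi K /\ forall i, ~ K i ->
    exists (B : C) (b : mor B S),
      [/\ nonzero B, phi ∘ b = 0, mono (coproduct_proj aP i ∘ b)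
        & b = partial_id aP K ∘ b + a i ∘ (coproduct_proj aP i ∘ b)].
Proof.
have [E|K [indK maxK]] := @Zorn_bigcup I (independent aP phi).
  exact: independent_bigcup.
exists K; split=> // i nKi; set Ki := (fun j => K j \/ j = i) : set I.
have /existsNP[Z /existsNP[z /not_implyP[zE /not_implyP[phiz z0]]]] :
    ~ independent aP phi Ki.
  apply: maxK; split=> [j Kj|KiK]; first by left.
  by apply: nKi; apply: KiK; right.
have [N [n [mn nE nP]]] := partial_image aP Ki.
have [h nh] := nP _ _ zE.
have [|B [k [mk B0 phik]]] := @not_mono_kernel _ aC _ _ (phi ∘ n).
  move/monoP => /(_ _ h); rewrite -compmA nh => /(_ phiz) h0.
  by apply: z0; rewrite -nh h0 compm0.
have nkE : n ∘ k = partial_id aP K ∘ (n ∘ k)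
    + a i ∘ (coproduct_proj aP i ∘ (n ∘ k)).
  by rewrite (compmA (a i)) -compDl -partial_id_add1 // (compmA _ n) nE.
exists B, (n ∘ k); split=> //; first by rewrite compmA.
apply/monoP => W w; rewrite -compmA => prw.
have : (n ∘ k) ∘ w = 0.
  apply: indK; last by rewrite (compmA phi) (compmA phi) phik comp0m.
  rewrite [in RHS]nkE compDl -!(compmA _ (n ∘ k)) (compmA (partial_id _ _)).
  by rewrite -(compmA (a i)) -(compmA (coproduct_proj _ _)) prw compm0 addr0 compmA.
by rewrite -compmA => nkw; apply: mk; apply: mn; rewrite nkw !compm0.
Qed.

(** The objects that are essential extensions of a direct sum of members of G,
    if G is closed under subobjects. This description makes it possible to
    decide membership by looking at subobjects only. *)
Definition saturation (G : set C) : set C := fun A =>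
  forall (W : C) (u : mor W A), mono u -> nonzero W ->
    exists (W' : C) (v : mor W' W), [/\ mono v, nonzero W' & G W'].

Definition hereditary (G : set C) : Prop :=
  forall (A B : C) (m : mor A B), mono m -> G B -> G A.

Lemma sub_saturation (G : set C) A : hereditary G -> G A -> saturation G A.
Proof.
move=> hG GA W u mu nW; exists W, 'id_W.
by split=> //; [apply: mono_id|apply: hG mu GA].
Qed.

Lemma saturation_sub (G : set C) : hereditary (saturation G).
Proof.
move=> A B m mm GB W u mu nW.
by apply: (GB W (m ∘ u)) => //; apply: mono_comp.
Qed.

(** A nonzero subobject W of a coproduct S contains a nonzero subobject that
    embeds into one of the summands: otherwise all of S would embed into S / W. *)
Lemma saturation_coproduct (G : set C) (I : Small) (F : I -> C) (S : C)
    (a : forall i, mor (F i) S) :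
  is_coproduct a -> (forall i, saturation G (F i)) -> saturation G S.
Proof.
move=> aP GF W u mu nW.
have [Q [f [fu0 fP]]] := mono_kernel aC mu.
have [K [indK maxK]] := maximal_independent aP f.
have [allK|/existsNP[i /maxK[B [b [nB fb0 mb bE]]]]] := pselect (forall i, K i).
  case: (mono_neq0 mu nW); apply: indK fu0.
  suff -> : partial_id aP K = 'id_S by rewrite comp_idm.
  by apply: (coproduct_eq aP) => i; rewrite partial_id_in // comp_idm.
have [h uh] := fP _ _ fb0.
have [W' [v [mv nW' GW']]] := GF i _ _ mb nB.
exists W', (h ∘ v); split=> //; apply: mono_comp mv.
by apply: (@mono_of_comp _ _ _ _ u); rewrite uh; apply: mono_of_comp mb.
Qed.

Lemma saturation_essential (G : set C) A B (m : mor A B) :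
  essential_mono m -> saturation G A -> saturation G B.
Proof.
move=> [mm ess] GA W u mu nW.
have [Q [f [fu0 fP]]] := mono_kernel aC mu.
have [mfm|/(not_mono_kernel aC)[N [k [mk nN fmk]]]] := pselect (mono (f ∘ m)).
  by case: (mono_neq0 mu nW); move/monoP: (ess _ _ mfm); apply.
have [W' [v [mv nW' GW']]] := GA _ _ mk nN.
have [|h uh] := fP _ (m ∘ k); first by rewrite compmA.
exists W', (h ∘ v); split=> //; apply: mono_comp mv.
by apply: (@mono_of_comp _ _ _ _ u); rewrite uh; apply: mono_comp.
Qed.

Lemma saturation_closed (G : set C) : essentially_closed (saturation G).
Proof.
split; [exact: saturation_coproduct|exact: saturation_sub
       |exact: saturation_essential].
Qed.

(** Subobjects of X are determined by the morphisms from a generator that factor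
    through them. This makes the collection of subobjects of X small. *)
Lemma factor_of_generator (P A B X : C) (a : mor A X) (b : mor B X) :
  is_generator P -> mono b ->
  (forall g : mor P A, exists h : mor P B, b ∘ h = a ∘ g) ->
  exists h : mor A B, b ∘ h = a.
Proof.
move=> genP mb ab; have [Q [f [fb0 fP]]] := mono_kernel aC mb; apply: fP.
apply: genP => g; have [h bh] := ab g.
by rewrite comp0m -compmA -bh compmA fb0 comp0m.
Qed.

Lemma factor_of_points (P A B X : C) (a : mor A X) (b : mor B X) :
  is_generator P -> mono b -> generator_points P a = generator_points P b ->
  exists h : mor A B, b ∘ h = a.
Proof.
move=> genP mb ab; apply: (factor_of_generator genP mb) => g.
have : generator_points P a (a ∘ g) by exists g.
by rewrite ab.
Qed.

(** If A is saturated with respect to G, then a maximal direct sum of subobjects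
    of A belonging to G is essential in A. *)
Lemma saturation_least (G S : set C) A :
  essentially_closed S -> (forall B, G B -> S B) -> saturation G A -> S A.
Proof.
move=> clS GS GA; have [P genP] := grothendieck_generator hC.
pose I := {s : set (mor P A) | exists (B : C) (b : mor B A),
  [/\ mono b, G B & s = generator_points P b]}.
pose F (i : I) := sval (cid (svalP i)).
pose b (i : I) : mor (F i) A := sval (cid (svalP (cid (svalP i)))).
have bP (i : I) : [/\ mono (b i), G (F i) & sval i = generator_points P (b i)] :=
  svalP (cid (svalP (cid (svalP i)))).
have [D [a aP]] := grothendieck_coproduct hC F.
have [phi [phiE _]] := aP A b.
have [K [indK maxK]] := maximal_independent aP phi.
have [N [n [mn nE nP]]] := partial_image aP K.
have SN : S N.
  apply: (closed_subobject clS mn); apply: (closed_coproduct clS aP) => i.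
  by apply: GS; case: (bP i).
apply: (@closed_essential _ _ clS _ _ (phi ∘ n) _ SN); split.
  apply/monoP => Z z; rewrite -compmA => phinz; apply: mn; rewrite compm0.
  by apply: indK phinz; rewrite compmA nE.
move=> Y g mg; apply: contrapT => /(not_mono_kernel aC)[W [u [mu nW gu0]]].
have [W' [v [mv nW' GW']]] := GA _ _ mu nW.
have muv : mono (u ∘ v) by apply: mono_comp.
pose i : I := exist _ (generator_points P (u ∘ v))
  (ex_intro _ W' (ex_intro _ (u ∘ v) (And3 muv GW' erefl))).
have [mb _ iE] := bP i.
have [h bh] := factor_of_points genP mb iE.
have [h' bh'] := factor_of_points genP muv (esym iE).
have gb0 : g ∘ b i = 0 by rewrite -bh' -compmA (compmA g) gu0 comp0m.
have b0 : b i <> 0.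
  by move=> b0; apply: (mono_neq0 muv nW'); rewrite -bh b0 comp0m.
move/monoP: mg => mg.
have [Ki|/maxK[B [c [nB phic mc cE]]]] := pselect (K i).
  have [|w nw] := nP _ (a i); first exact: partial_id_in.
  apply: b0; rewrite -phiE -nw; have -> : w = 0; last by rewrite !compm0.
  by apply: mg; rewrite -!compmA nw phiE.
have [|w nw] := nP _ (partial_id aP K ∘ c).
  by rewrite compmA partial_id_sub.
have w0 : w = 0.
  apply: mg; rewrite -!compmA nw.
  have : g ∘ (phi ∘ c) = 0 by rewrite phic compm0.
  rewrite {1}cE compDr compDr (compmA phi (a i)) phiE (compmA g (b i)) gb0.
  by rewrite comp0m addr0.
apply: (mono_neq0 mc nB).
move: phic; rewrite {1}cE -nw w0 compm0 add0r compmA phiE => bpr0.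
by apply: mb; rewrite bpr0 compm0.
Qed.

Definition embeds_in B : set C := fun A => exists m : mor A B, mono m.

Lemma embeds_in_hereditary B : hereditary (embeds_in B).
Proof. by move=> A D m mm [n mn]; exists (n ∘ m); apply: mono_comp. Qed.

Lemma ess_genE U : ess_gen U = saturation (embeds_in U).
Proof.
apply/seteqP; split=> A.
  apply; split; first exact: saturation_closed.
  move=> _ ->; apply: sub_saturation; first exact: embeds_in_hereditary.
  by exists 'id_U; apply: mono_id.
move=> satA S [clS US]; apply: (saturation_least clS) satA => B [m mm].
by apply: (closed_subobject clS mm); apply: US.
Qed.

End Saturation.
(** * Splitting an injective object along a hereditary class *)

Section InjectiveSplitting.
Variable C : preadditive_category.
Hypothesis hC : grothendieck C.
Let aC := grothendieck_abelian hC.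
Implicit Types A B D X : C.

(** The union clause is the one of [directed_union]. A chain of subobjects is
    indexed by the sets of their points, which form a small type whereas the
    objects of the category need not. *)
Lemma maximal_subobject X (P : forall A, mor A X -> Prop) :
  (exists (A : C) (a : mor A X), mono a /\ P A a) ->
  (forall (T : Small) (F : T -> C) (phi : forall t, mor (F t) X)
      (L : C) (l : mor L X) (inj : forall t, mor (F t) L),
    (forall t, mono (phi t)) -> (forall t, P (F t) (phi t)) -> mono l ->
    (forall t, l ∘ inj t = phi t) ->
    (forall Z (psi : mor L Z), (forall t, mono (psi ∘ inj t)) -> mono psi) ->
    P L l) ->
  exists (A : C) (a : mor A X), [/\ mono a, P A a
    & forall (B : C) (b : mor B X), mono b -> P B b ->
        (exists h, b ∘ h = a) -> exists h, a ∘ h = b].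
Proof.
move=> [A0 [a0 [ma0 Pa0]]] Pcup.
have [G genG] := grothendieck_generator hC.
pose V := {A : C & {a : mor A X | mono a /\ P A a}}.
pose m (x : V) : mor (projT1 x) X := sval (projT2 x).
have mm x : mono (m x) by case: (svalP (projT2 x)).
have mP x : P _ (m x) by case: (svalP (projT2 x)).
pose R (x y : V) := `[< exists h, m y ∘ h = m x >].
pose x0 : V := existT _ A0 (exist _ a0 (conj ma0 Pa0)).
have R_refl x : R x x by apply/asboolP; exists 'id_(projT1 x); rewrite compm_id.
have R_trans x y z : R x y -> R y z -> R x z.
  move=> /asboolP[h xy] /asboolP[k yz]; apply/asboolP.
  by exists (k ∘ h); rewrite compmA yz.
have [E totE|[A [a [ma Pa]]] maxa] := @ZL_preorder V x0 R R_refl R_trans; last first.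
  exists A, a; split=> // B b mb Pb ab.
  pose x : V := existT _ B (exist _ b (conj mb Pb)).
  by have /asboolP[h bh] := maxa x (asboolT ab); exists h.
have [[y0 Ey0]|E0] := pselect (exists x, E x); last first.
  by exists x0 => x Ex; case: E0; exists x.
pose T := {s : set (mor G X) | exists x, E x /\ s = generator_points G (m x)}.
pose f (t : T) : V := sval (cid (svalP t)).
have fE (t : T) : E (f t) /\ sval t = generator_points G (m (f t)) :=
  svalP (cid (svalP t)).
pose t0 : T := exist _ (generator_points G (m y0)) (ex_intro _ y0 (conj Ey0 erefl)).
have [||||| L [l [inj [ml lE Lmono]]]] := @directed_union C hC T
    (fun s t => R (f s) (f t)) X (fun t => projT1 (f t)) (fun t => m (f t))
    (inhabits t0).
- by move=> t; apply: R_refl.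
- by move=> s t u tu st; apply: R_trans st tu.
- move=> s t; have [[Es _] [Et _]] := (fE s, fE t).
  by have [st|ts] := totE _ _ Es Et; [exists t|exists s]; split=> //; apply: R_refl.
- by move=> t; apply: mm.
- by move=> s t /asboolP.
have Pl : P L l by apply: Pcup ml lE Lmono => t; [apply: mm|apply: mP].
exists (existT _ L (exist _ l (conj ml Pl))) => x Ex; apply/asboolP.
pose t : T := exist _ (generator_points G (m x)) (ex_intro _ x (conj Ex erefl)).
have [h hE] := factor_of_points hC genG (mm _) (fE t).2.
by exists (inj t ∘ h); rewrite compmA /m /= lE.
Qed.

Lemma mono_from_zero Z B (f : mor Z B) : is_zero_object Z -> mono f.
Proof. by move=> Z0 Y u v _; rewrite ((Z0 Y).1 u) ((Z0 Y).1 v). Qed.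

Lemma zero_saturation (G : set C) Z : is_zero_object Z -> saturation G Z.
Proof. by move=> Z0 W u mu /(mono_neq0 mu); rewrite ((Z0 W).1 u). Qed.

Lemma product_eq A B D Y (p : mor D A) (q : mor D B) (u v : mor Y D) :
  is_product p q -> p ∘ u = p ∘ v -> q ∘ u = q ∘ v -> u = v.
Proof.
by move=> /(_ _ (p ∘ u) (q ∘ u))[h [_ hU]] pu qu; rewrite -(hU u) // (hU v).
Qed.

Lemma saturation_product (G : set C) A B D (p : mor D A) (q : mor D B) :
  hereditary G -> is_product p q -> saturation G A -> G B -> saturation G D.
Proof.
move=> hG pq GA GB W u mu nW.
have [mpu|/(not_mono_kernel aC)[N [k [mk nN puk]]]] := pselect (mono (p ∘ u)).
  exact: GA mpu nW.
exists N, k; split=> //; apply: hG GB; apply: (_ : mono (q ∘ (u ∘ k))).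
apply/monoP => Y y qy; apply: mk; apply: mu; rewrite !compm0.
apply: (product_eq pq); rewrite !compm0.
  by rewrite !compmA puk comp0m.
by rewrite -qy -!compmA.
Qed.

(** A maximal saturated subobject of X exists because a nonzero subobject of the
    union of a chain meets some member of the chain. *)
Lemma maximal_saturated X (G : set C) :
  exists (A : C) (a : mor A X), [/\ mono a, saturation G A
    & forall (B : C) (b : mor B X), mono b -> saturation G B ->
        (exists h, b ∘ h = a) -> exists h, a ∘ h = b].
Proof.
apply: (maximal_subobject (P := fun A _ => saturation G A)).
  have [Z Z0] := abelian_zero aC.
  by exists Z, 0; split; [apply: mono_from_zero|apply: zero_saturation].
move=> T F phi L l inj mphi GF ml lE Lmono W u mu nW.
have [Q [f [fu0 fP]]] := mono_kernel aC mu.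
have [/Lmono mf|] := pselect (forall t, mono (f ∘ inj t)).
  by case: (mono_neq0 mu nW); move/monoP: mf; apply.
move=> /existsNP[t /(not_mono_kernel aC)[N [k [mk nN fk]]]].
have [W' [v [mv nW' GW']]] := GF t _ _ mk nN.
have [|h uh] := fP _ (inj t ∘ k); first by rewrite compmA.
exists W', (h ∘ v); split=> //; apply: mono_comp mv.
apply: (@mono_of_comp _ _ _ _ u); rewrite uh; apply: mono_comp mk.
by apply: (@mono_of_comp _ _ _ _ l); rewrite lE.
Qed.

(** A subobject b maximal with zero intersection with a: the quotient of X by b
    is then an essential extension of a. *)
Lemma essential_quotient X A (a : mor A X) : mono a ->
  exists (Q : C) (c : mor X Q), essential_mono (c ∘ a).
Proof.
move=> ma; have [D [q [qa0 qP]]] := mono_kernel aC ma.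
have [||B [b [mb mqb maxb]]] :=
    @maximal_subobject X (fun B b => mono (q ∘ b)).
- have [Z Z0] := abelian_zero aC.
  by exists Z, 0; split; apply: mono_from_zero.
- move=> T F phi L l inj _ mqphi _ lE; apply=> t.
  by rewrite -compmA lE.
move/monoP: (mqb) => qb0.
have [Q [c cokc]] := abelian_cokernel aC b.
have [cb0 _] := cokc.
have [_ bP] := kernel_cokernel aC mb cokc.
exists Q, c; split.
  apply/monoP => Y y; rewrite -compmA => /bP[y' [by' _]].
  apply: ma; rewrite compm0 -by'.
  have -> : y' = 0 by apply: qb0; rewrite -compmA by' compmA qa0 comp0m.
  by rewrite compm0.
move=> Y m /monoP mca.
have [K [k kerk]] := abelian_kernel aC (m ∘ c).
have [mk [mck kP]] := (kernel_mono kerk, kerk).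
(* The kernel of m ∘ c contains b and meets a trivially, so it is b. *)
have [||h bh] := maxb K k mk.
- apply/monoP => W w; rewrite -compmA => /qP[w' aw'].
  apply: mk; rewrite compm0 -aw'.
  have -> : w' = 0.
    by apply: mca; rewrite -!compmA aw' (compmA c) (compmA m) (compmA m) mck comp0m.
  by rewrite compm0.
- have [|h [kh _]] := kP _ b; first by rewrite -compmA cb0 compm0.
  by exists h.
apply: (mono_of_coimage aC (f := m ∘ c) (k := b)) cokc erefl.
split=> [|W w /kP[w' [kw' _]]]; first by rewrite -compmA cb0 compm0.
exists (h ∘ w'); split=> [|w'' bw'']; first by rewrite compmA bh.
by apply: mb; rewrite compmA bh kw'.
Qed.

(** The last clause speaks of the complement A' of A: the morphisms y that remain
    injective after projection to A' are the embeddings of Y into A' up to the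
    choice of a component in A. *)
Definition saturated_part X (G : set C) (A : summand X) (p : mor X A) : Prop :=
  [/\ p ∘ summand_inc A = 'id_A, saturation G A
    & forall (Y : C) (y : mor Y X), G Y ->
        mono (('id_X - summand_inc A ∘ p) ∘ y) -> ~ nonzero Y].

(** An injective object splits as A ⊕ A' where A is saturated with respect to G
    and A' contains no nonzero member of G. Take A maximal among the saturated
    subobjects. An essential extension of A that is a quotient of X embeds into
    X over A by injectivity; it is saturated, hence equal to A, so that A is a
    retract. If Y in G embedded into A', then A ⊕ Y would contradict the
    maximality of A. *)
Lemma injective_splitting X (G : set C) : injective_object X -> hereditary G ->
  exists (A : summand X) (p : mor X A), saturated_part G p.
Proof.
move=> injX hG; have [A [a [ma GA maxa]]] := maximal_saturated X G.
have [Q [c essca]] := essential_quotient ma.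
have [mca ess] := essca.
have [j jca] := injX _ _ (c ∘ a) a mca.
have mj : mono j by apply: ess; rewrite jca.
have [|s as_] := maxa Q j mj (saturation_essential hC essca GA).
  by exists (c ∘ a).
have pa : (s ∘ c) ∘ a = 'id_A.
  by apply: ma; rewrite -compmA compmA as_ jca compm_id.
pose U := Summand (ex_intro _ (s ∘ c) pa).
exists U, (s ∘ c); split=> // Y y GY; set e' := 'id_X - _ => /monoP me'y nY.
have pe' : (s ∘ c) ∘ e' = 0.
  by rewrite compBr compm_id compmA pa comp_idm subrr.
have e'a : e' ∘ a = 0.
  by rewrite compBl comp_idm -compmA pa compm_id subrr.
have e'e' : e' ∘ e' = e'.
  by rewrite {1}/e' compBl comp_idm -compmA pe' compm0 subr0.
have [D [p1 [p2 pP]]] := abelian_product aC A Y.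
pose d := a ∘ p1 + (e' ∘ y) ∘ p2.
have [i1 [[p1i1 p2i1] _]] := pP _ 'id_A 0.
have [i2 [[p1i2 p2i2] _]] := pP _ 0 'id_Y.
have [||t at_] := maxa D d _ (saturation_product hG pP GA GY).
- apply/monoP => Z z; rewrite compDl -!compmA => dz.
  have p1z : p1 ∘ z = 0.
    have := f_equal (fun x => (s ∘ c) ∘ x) dz.
    rewrite compDr compm0 (compmA _ a) pa comp_idm (compmA _ e') pe' comp0m.
    by rewrite addr0.
  apply: (product_eq pP); rewrite compm0 //; apply: me'y.
  by rewrite -compmA -dz p1z compm0 add0r.
- exists i1; by rewrite compDl -!compmA p1i1 p2i1 !compm0 compm_id addr0.
have := f_equal (fun x => e' ∘ (x ∘ i2)) at_.
rewrite /d -(compmA a) (compmA e') e'a comp0m compDl -!compmA p1i2 p2i2.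
rewrite compm0 add0r compm_id compmA e'e' => /esym e'y.
by apply: nY; apply: me'y; rewrite compm_id.
Qed.

End InjectiveSplitting.
(** * The Jacobson radical of the endomorphism ring *)

Section JacobsonRing.
Variable R : pzRingType.
Implicit Types (x a l : R) (L : set R).

Lemma left_idealD L x y : left_ideal L -> L x -> L y -> L (x + y).
Proof.
move=> [L0 LB _] Lx Ly; rewrite -[y]opprK; apply: (LB) => //.
by rewrite -[- y]add0r; apply: LB.
Qed.

Lemma maximal_left_ideal_exists x : (forall l, l * x <> 1) ->
  exists L, maximal_left_ideal L /\ L x.
Proof.
move=> nx.
(* The empty set is allowed, because it is the union of the empty chain. *)
pose P : set (set R) := fun L => ~ L 1 /\ (forall y, L y -> left_ideal L /\ L x).
have [E EP totE|L [[L1 LP] Lmax]] := @Zorn_bigcup R P.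
  split=> [[L EL L1]|y [L EL Ly]]; first by case: (EP _ EL).
  have [lL Lx] := (EP _ EL).2 _ Ly.
  split; last by exists L.
  split; first by exists L => //; case: lL.
    move=> u v [L1 EL1 Lu] [L2 EL2 Lv].
    have [sub|sub] := totE _ _ EL1 EL2.
      exists L2 => //; have [l2 _] := (EP _ EL2).2 _ Lv.
      by apply: left_idealB => //; apply: sub.
    exists L1 => //; have [l1 _] := (EP _ EL1).2 _ Lu.
    by apply: left_idealB => //; apply: sub.
  move=> b u [L' EL' Lu]; exists L' => //.
  by have [l' _] := (EP _ EL').2 _ Lu; apply: left_idealM.
have Rx_ideal : left_ideal [set y | exists a, y = a * x]%classic.
  split; first by exists 0; rewrite mul0r.
    by move=> _ _ [a ->] [b ->]; exists (a - b); rewrite mulrBl.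
  by move=> b _ [a ->]; exists (b * a); rewrite mulrA.
have [[y Ly]|L0] := pselect (exists y, L y); last first.
  exfalso; apply: (Lmax [set y | exists a, y = a * x]%classic).
    split; first by move=> y Ly; case: L0; exists y.
    move=> /(_ (1 * x)) sub.
    by apply: L0; exists (1 * x); apply: sub; exists 1.
  split=> [[a /esym]|y _]; first exact: nx.
  by split=> //; exists 1; rewrite mul1r.
have [lL Lx] := LP _ Ly.
exists L; split=> //; split=> // [LT|M lM LM].
  by apply: L1; rewrite LT.
have [M1|nM1] := pselect (M 1).
  right; apply/seteqP; split=> // z _.
  by rewrite -[z]mulr1; apply: left_idealM.
left; apply/seteqP; split=> // z Mz; apply: contrapT => nLz.
apply: (Lmax M); first by split=> // ML; apply: nLz; apply: ML.
by split=> // _ _; split=> //; apply: LM.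
Qed.

Lemma jacobson_left_invertible x :
  x \in @jacobson R <-> forall a, exists l, l * (1 - a * x) = 1.
Proof.
split=> [Jx a|xP].
  apply: contrapT => nl.
  have [|L [[lL LT Lmax] L1]] := @maximal_left_ideal_exists (1 - a * x).
    by move=> l lax; apply: nl; exists l.
  apply: (LT); apply/seteqP; split=> // z _; rewrite -[z]mulr1.
  apply: left_idealM => //; rewrite -[1](subrK (a * x)).
  apply: left_idealD => //; apply: left_idealM => //.
  by move/jacobsonP: Jx => /(_ L); apply; split.
apply/jacobsonP => L [lL LT Lmax]; apply: contrapT => nLx.
pose M := [set z | exists l a, L l /\ z = l + a * x]%classic.
have [||ML|MT] := Lmax M.
- case: lL => L0 LB LM; split.
  + by exists 0, 0; rewrite mul0r addr0.
  + move=> _ _ [l [a [Ll ->]]] [l' [a' [Ll' ->]]].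
    exists (l - l'), (a - a'); split; first exact: LB.
    by rewrite mulrBl opprD addrACA.
  + move=> b _ [l [a [Ll ->]]]; exists (b * l), (b * a).
    by split; [apply: LM|rewrite mulrDr mulrA].
- by move=> l Ll; exists l, 0; rewrite mul0r addr0.
- apply: nLx; rewrite -ML; exists 0, 1.
  by split; [case: lL|rewrite add0r mul1r].
- have [l [a [Ll l1]]] : M 1 by rewrite MT.
  have [l' l'l] := xP a.
  apply: LT; apply/seteqP; split=> // z _; rewrite -[z]mulr1 -l'l mulrA.
  by apply: left_idealM => //; rewrite l1 addrK.
Qed.

Lemma modJ_mulE x y : modJ x * modJ y = modJ (x * y).
Proof. exact: modJM. Qed.

Lemma modJ_sub x y : modJ (x - y) = modJ x - modJ y.
Proof. exact: raddfB. Qed.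

Lemma modJ_eq0 x : modJ x = 0 <-> x \in @jacobson R.
Proof.
by rewrite -{2}[x]subr0 -modJ_eq raddf0; split=> [->|/eqP].
Qed.

End JacobsonRing.

Section Endomorphisms.
Variable C : preadditive_category.
Hypothesis hC : grothendieck C.
Let aC := grothendieck_abelian hC.
Variable X : C.
Hypothesis injX : injective_object X.

(** Equivalently, the kernel of f is an essential subobject. *)
Definition negligible A B (f : mor A B) : Prop :=
  forall (Y : C) (y : mor Y A), mono (f ∘ y) -> ~ nonzero Y.

(** Morphisms with essential kernel form the radical of End(X). If f is such a
    morphism, then 1 - g f is injective, since f is injective on its kernel; so
    it has a left inverse. Conversely, if f is injective on a subobject y, then g
    with g f y = y exists, and a left inverse of 1 - g f forces y to vanish. *)
Lemma jacobson_negligible (f : End X) : f \in @jacobson (End X) <-> negligible f.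
Proof.
rewrite jacobson_left_invertible; split=> [fP Y y mfy nY|negf g].
  have [g gfy] := injX y mfy.
  have [l l1] := fP g.
  apply: (mono_neq0 (mono_of_comp mfy) nY).
  have l1' : l ∘ ('id_X - g ∘ f) = 'id_X := l1.
  rewrite -[y]comp_idm -l1' -compmA compBl comp_idm -(compmA g) gfy.
  by rewrite subrr compm0.
have m1 : mono ('id_X - g ∘ f).
  apply: contrapT => /(not_mono_kernel aC)[K [k [mk nK]]].
  rewrite compBl comp_idm => /eqP; rewrite subr_eq0 => /eqP kE.
  apply: (negf K k) nK; apply: (@mono_of_comp _ _ _ _ g).
  by rewrite compmA -kE.
have [l l1] := injX 'id_X m1.
by exists l.
Qed.

Lemma modJ_negligible (f : End X) : modJ f = 0 <-> negligible f.
Proof. by rewrite modJ_eq0 jacobson_negligible. Qed.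

Lemma End_mulE (f g : End X) : f * g = f ∘ g.
Proof. by []. Qed.

Definition summand_idem (V : summand X) (q : mor X V) : End X :=
  summand_inc V ∘ q.

Lemma summand_idem_inc (V : summand X) (q : mor X V) :
  q ∘ summand_inc V = 'id_V -> summand_idem q ∘ summand_inc V = summand_inc V.
Proof. by move=> qV; rewrite -compmA qV compm_id. Qed.

Lemma modJ_fixedP (e f : End X) :
  modJ e * modJ f = modJ f <-> negligible (('id_X - e) ∘ f).
Proof.
rewrite -modJ_negligible.
have -> : modJ (('id_X - e) ∘ f : End X) = modJ f - modJ e * modJ f.
  by rewrite modJ_mulE -modJ_sub -{2}[f]mul1r -mulrBl.
by split=> [->|/eqP]; [rewrite subrr|rewrite subr_eq0 => /eqP].
Qed.

Section SaturatedPart.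
Variables (G : set C) (A : summand X) (p : mor X A).
Hypothesis GA : saturated_part G p.
Let e := summand_idem p.
Let e' : End X := 'id_X - e.

Lemma saturated_part_split : p ∘ summand_inc A = 'id_A.
Proof. by case: GA. Qed.

Lemma saturated_part_inside Y (y : mor Y X) : mono (p ∘ y) -> saturation G Y.
Proof. by move=> mpy; apply: saturation_sub mpy _; case: GA. Qed.

Lemma saturated_part_outside Y (y : mor Y X) (W : C) (u : mor W Y) :
  mono (e' ∘ y) -> saturation G W -> mono u -> ~ nonzero W.
Proof.
move=> me'y GW mu nW.
have [W' [v [mv nW' GW']]] := GW _ _ (@mono_id _ W) nW.
case: GA => _ _ /(_ W' (y ∘ (u ∘ v)) GW'); apply=> //.
by rewrite (compmA _ y); do 2!apply: mono_comp => //.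
Qed.

(** A and its complement A' have no nonzero subobjects in common, so all
    morphisms between them are negligible: modulo the radical, the ring splits as
    a product. *)
Lemma saturated_part_central : central_idempotent (modJ e).
Proof.
have ee : e * e = e.
  rewrite End_mulE {2}/e /summand_idem compmA summand_idem_inc //.
  exact: saturated_part_split.
apply/andP; split; first by rewrite modJ_mulE ee.
apply/asboolP => y; rewrite -[y]modJ_repr; set r := repr y.
have h1 : modJ (e' * (r * e)) = 0.
  apply/modJ_negligible => Y z mz nY.
  apply: (saturated_part_outside (y := (r ∘ e) ∘ z) (u := 'id_Y)) nY.
  - by rewrite compmA.
  - apply: (@saturated_part_inside _ z).
    by move: mz; rewrite !End_mulE -!compmA; do 3!move/mono_of_comp.
  - exact: mono_id.
have h2 : modJ (e * (r * e')) = 0.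
  apply/modJ_negligible => Y z mz nY.
  apply: (saturated_part_outside (y := z) (u := 'id_Y)) nY.
  - by apply: (@mono_of_comp _ _ _ _ (e ∘ r)); move: mz; rewrite !End_mulE !compmA.
  - apply: (@saturated_part_inside _ ((r ∘ e') ∘ z)).
    by move: mz; rewrite !End_mulE -!compmA => /mono_of_comp.
  - exact: mono_id.
have e'E : e' = 1 - e by [].
move: h1 h2; rewrite e'E !mulrBr !mulr1 mulrBl mul1r !modJ_sub.
move=> /eqP; rewrite subr_eq0 => /eqP re /eqP; rewrite subr_eq0 => /eqP er.
by rewrite /GRing.comm !modJ_mulE re er.
Qed.

(** If V is saturated, then it has no nonzero subobject in common with A', so its
    image in A' is negligible. Conversely, if that image is negligible, then every
    nonzero subobject of V contains a nonzero one killed by the projection to A',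
    which therefore lies in A. *)
Lemma saturated_part_fix (V : summand X) (q : mor X V) :
  saturation G V -> modJ e * modJ (summand_idem q) = modJ (summand_idem q).
Proof.
move=> GV; apply/modJ_fixedP => Y y my.
apply: (saturated_part_outside (y := summand_inc V ∘ (q ∘ y)) (u := 'id_Y)).
- by move: my; rewrite !compmA.
- apply: (saturation_sub (m := q ∘ y)) GV; move: my.
  by rewrite -!compmA (compmA _ (summand_inc V)); apply: mono_of_comp.
- exact: mono_id.
Qed.

Lemma saturated_part_fixed (V : summand X) (q : mor X V) :
  q ∘ summand_inc V = 'id_V ->
  modJ e * modJ (summand_idem q) = modJ (summand_idem q) ->
  saturation (embeds_in A) V.
Proof.
move=> qV /modJ_fixedP neg W u mu nW.
have /(not_mono_kernel aC)[N [k [mk nN]]] :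
    ~ mono ((('id_X - e) ∘ summand_idem q) ∘ (summand_inc V ∘ u)).
  by move=> /neg.
rewrite -(compmA _ (summand_idem q)) (compmA _ (summand_inc V)) summand_idem_inc //.
rewrite -compmA compBl comp_idm => /eqP; rewrite subr_eq0 => /eqP iukE.
exists N, k; split=> //; exists (p ∘ (summand_inc V ∘ (u ∘ k))).
apply: (@mono_of_comp _ _ _ _ (summand_inc A)).
rewrite compmA [X in mono X](_ : _ = summand_inc V ∘ (u ∘ k)); last first.
  by rewrite [in RHS](compmA _ u) iukE -(compmA _ u).
by apply: mono_comp (split_mono qV) _; apply: mono_comp.
Qed.

End SaturatedPart.

(** A central idempotent c that fixes U fixes whatever is saturated with respect
    to the subobjects of U: a subobject of V embedded into U can be moved into U
    by an endomorphism r of X, and c commutes with r. *)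
Lemma central_fix_saturation (c : mod_jacobson (End X)) (U V : summand X)
    (p : mor X U) (q : mor X V) :
  central_idempotent c -> p ∘ summand_inc U = 'id_U ->
  saturation (embeds_in U) V ->
  c * modJ (summand_idem p) = modJ (summand_idem p) ->
  c * modJ (summand_idem q) = modJ (summand_idem q).
Proof.
move=> /andP[_ /asboolP cC] pU UV.
move: cC; rewrite -[c]modJ_repr; set h := repr c => cC cU.
apply/modJ_fixedP => Y y my nY.
have mqy : mono (q ∘ y).
  move: my; rewrite -compmA -(compmA (summand_inc V)) (compmA _ (summand_inc V)).
  exact: mono_of_comp.
have [W [v [mv nW [j mj]]]] := UV _ _ mqy nY.
have mij : mono (summand_inc U ∘ j) by apply: mono_comp mj; apply: split_mono pU.
have [r rE] := injX (summand_idem q ∘ (y ∘ v)) mij.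
have : modJ (('id_X - h : End X) * ((r : End X) * summand_idem p)) = 0.
  have -> : 'id_X - h = 1 - h :> End X by [].
  rewrite mulrBl mul1r modJ_sub -!modJ_mulE mulrA cC -mulrA cU.
  exact: subrr.
move=> /modJ_negligible /(_ W (summand_inc U ∘ j)); apply=> //.
rewrite [X in mono X](_ : _ = (('id_X - h) ∘ summand_idem q) ∘ y ∘ v).
  exact: mono_comp.
apply: (_ : (('id_X - h) ∘ (r ∘ summand_idem p)) ∘ (summand_inc U ∘ j) = _).
rewrite -!(compmA ('id_X - h)) -(compmA r) (compmA (summand_idem p)).
by rewrite summand_idem_inc // rE !compmA.
Qed.

(** Every central idempotent c of the quotient comes from a summand of X. Lift c
    to an endomorphism h. The class G of objects on which h is the identity, under
    some embedding into X, determines a splitting of X; c is the identity on its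
    first part and zero on the second, because an object y of the second part on
    which h is injective would give the member h y of G. *)
Lemma central_idempotent_lift (c : Blat (mod_jacobson (End X))) :
  exists (A : summand X) (p : mor X A),
    p ∘ summand_inc A = 'id_A /\ modJ (summand_idem p) = Bval c.
Proof.
set h := repr (Bval c); have hE : modJ h = Bval c := modJ_repr _.
pose G : set C := fun Y => exists y : mor Y X, mono y /\ h ∘ y = y.
have hG : hereditary G.
  move=> A B m mm [y [my hy]]; exists (y ∘ m).
  by rewrite compmA hy; split=> //; apply: mono_comp.
have [A [p GA]] := injective_splitting hC injX hG.
have pA := saturated_part_split GA.
exists A, p; split=> //; set e := summand_idem p; set e' := 'id_X - e : End X.
have ce : Bval c * modJ e = modJ e.
  rewrite -hE; apply/modJ_fixedP => Y y my nY.
  have mpy : mono (p ∘ y).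
    move: my; rewrite -compmA -(compmA (summand_inc A)) (compmA _ (summand_inc A)).
    exact: mono_of_comp.
  have [_ GAA _] := GA.
  have [W [v [mv nW [g [mg hg]]]]] := GAA _ _ mpy nY.
  have [r rE] := injX (e ∘ (y ∘ v)) mg.
  have : modJ ((1 - h) * (r : End X) - (r : End X) * (1 - h)) = 0.
    rewrite modJ_sub -!modJ_mulE modJ_sub (rmorph1 (@modJ (End X))) hE.
    by rewrite mulrBl mulrBr mulr1 mul1r Bval_comm subrr.
  move=> /modJ_negligible /(_ W g); apply=> //.
  rewrite [X in mono X](_ : _ = (('id_X - h) ∘ e) ∘ y ∘ v).
    exact: mono_comp.
  apply: (_ : (('id_X - h) ∘ r - r ∘ ('id_X - h)) ∘ g = _).
  rewrite compBl -!compmA rE (compBl 'id_X h g) comp_idm hg subrr compm0.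
  by rewrite subr0 -(compmA (summand_inc A)).
have ce' : Bval c * modJ e' = 0.
  rewrite -hE modJ_mulE; apply/modJ_negligible => Y y my nY.
  have : modJ (h * h - h) = 0.
    by rewrite modJ_sub -modJ_mulE hE Bval_idem subrr.
  move=> /modJ_negligible negh.
  have /(not_mono_kernel aC)[W [k [mk nW]]] : ~ mono ((h * h - h) ∘ (e' ∘ y)).
    by move=> /negh.
  move=> hk.
  have {}hk : h ∘ (h ∘ (e' ∘ y) ∘ k) = h ∘ (e' ∘ y) ∘ k.
    apply/eqP; rewrite -subr_eq0; apply/eqP; rewrite -{}hk.
    by rewrite (compBl (h ∘ h) h) compBl -!compmA.
  case: GA => _ _ /(_ W (y ∘ k)); apply=> //.
    exists (h ∘ (e' ∘ y) ∘ k); split=> //; apply: mono_comp mk.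
    by move: my; rewrite -compmA.
  apply: (_ : mono (e' ∘ (y ∘ k))); rewrite compmA; apply: mono_comp mk.
  by move: my; rewrite -compmA; apply: mono_of_comp.
rewrite -ce -[RHS]mulr1 (_ : 1 = modJ e + modJ e').
  by rewrite mulrDr ce' addr0.
by rewrite -modJD addrC subrK (rmorph1 (@modJ (End X))).
Qed.

End Endomorphisms.
(** * The lattice isomorphism *)

Section CentralSupport.
Variable C : preadditive_category.
Hypothesis hC : grothendieck C.
Variable X : C.
Hypothesis injX : injective_object X.
Implicit Types (U V : summand X) (x y z : Dlat X).
Implicit Types c : Blat (mod_jacobson (End X)).

Lemma ess_gen_sub (U V : C) :
  (ess_gen U `<=` ess_gen V)%classic <-> saturation (embeds_in V) U.
Proof.
rewrite !(ess_genE hC); split=> [|UV A].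
  apply; apply: sub_saturation; first exact: embeds_in_hereditary.
  by exists 'id_U; apply: mono_id.
apply: (saturation_least hC (saturation_closed hC _)) => B [m mm].
exact: saturation_sub mm UV.
Qed.

(** The central support of U is the class of the projection onto the largest
    part of X that is saturated with respect to the subobjects of U. *)
Lemma central_support_exists U : exists c,
  (forall V (q : mor X V), q ∘ summand_inc V = 'id_V ->
     Bval c * modJ (summand_idem q) = modJ (summand_idem q) <->
     saturation (embeds_in U) V) /\
  (forall (p : mor X U) c', p ∘ summand_inc U = 'id_U ->
     Bval c' * modJ (summand_idem p) = modJ (summand_idem p) -> (c <= c')%O).
Proof.
have [A [p GA]] := injective_splitting hC injX (@embeds_in_hereditary _ U).
have cA := saturated_part_central hC injX GA.
have [pA UA _] := GA.
exists (CentralIdempotent cA); split=> [V q qV|q c' qU c'U].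
  split=> [/(saturated_part_fixed hC injX qV) AV|].
    apply: (saturation_least hC (saturation_closed hC _)) AV => B [m mm].
    exact: saturation_sub mm UA.
  exact: saturated_part_fix.
have := central_fix_saturation hC injX p (BvalP c') qU UA c'U.
by rewrite Ble_def -Bval_comm => /eqP.
Qed.

Definition central_support U : Blat (mod_jacobson (End X)) :=
  sval (cid (central_support_exists U)).

Lemma central_supportP U V (q : mor X V) : q ∘ summand_inc V = 'id_V ->
  Bval (central_support U) * modJ (summand_idem q) = modJ (summand_idem q) <->
  saturation (embeds_in U) V.
Proof. exact: (svalP (cid (central_support_exists U))).1. Qed.

Lemma central_support_le U (p : mor X U) c : p ∘ summand_inc U = 'id_U ->
  Bval c * modJ (summand_idem p) = modJ (summand_idem p) ->
  (central_support U <= c)%O.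
Proof. exact: (svalP (cid (central_support_exists U))).2. Qed.

Lemma central_support_leE U V :
  (central_support U <= central_support V)%O =
  `[< (ess_gen U `<=` ess_gen V)%classic >].
Proof.
have [p pU] := summand_split U.
apply/idP/asboolP => [UV|/ess_gen_sub UV]; last first.
  by apply: (central_support_le pU); apply/(central_supportP V pU).
apply/ess_gen_sub/(central_supportP V pU).
have /(central_supportP U pU) UU : saturation (embeds_in U) U by apply/ess_gen_sub.
rewrite -UU mulrA; congr (_ * _).
by move: UV; rewrite Ble_def Bval_comm => /eqP.
Qed.

Definition Dlat_support x : Blat (mod_jacobson (End X)) := central_support (repr x).

Lemma Dlat_support_le x y : (Dlat_support x <= Dlat_support y)%O = (x <= y)%O.
Proof. exact: central_support_leE. Qed.

Lemma Dlat_support_class U : Dlat_support (Dclass U) = central_support U.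
Proof.
by apply/eqP; rewrite eq_le !central_support_leE ess_gen_repr !asboolT.
Qed.

Lemma Dlat_support_inj : injective Dlat_support.
Proof. by move=> x y xy; apply/eqP; rewrite eq_le -!Dlat_support_le xy lexx. Qed.

Lemma Dlat_support_surj c : exists x, Dlat_support x = c.
Proof.
have [A [p [pA eA]]] := central_idempotent_lift hC injX c.
exists (Dclass A); rewrite Dlat_support_class; apply/eqP; rewrite eq_le.
have /(central_supportP A pA) AA : saturation (embeds_in A) A by apply/ess_gen_sub.
apply/andP; split; last by rewrite Ble_def Bval_comm -eA AA.
by apply: (central_support_le pA); rewrite eA Bval_idem.
Qed.

(** The supremum of a family of summands is the part of X saturated with respect
    to all subobjects of the members of the family. *)
Lemma Dlat_supremum (E : set (Dlat X)) : (supremums E !=set0)%classic.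
Proof.
pose G : set C := fun B => exists x, E x /\ embeds_in (repr x) B.
have hG : hereditary G.
  by move=> A B m mm [x [Ex Bx]]; exists x; split=> //; exact: embeds_in_hereditary mm Bx.
have [A [p GA]] := injective_splitting hC injX hG.
exists (Dclass A); split=> [x Ex|z zE].
  rewrite -[x]reprK Dclass_le; apply/asboolP/ess_gen_sub.
  have [q qx] := summand_split (repr x).
  apply: (saturated_part_fixed hC injX qx (saturated_part_fix hC injX GA q _)).
  apply: sub_saturation => //; exists x; split=> //.
  by exists 'id_(repr x); apply: mono_id.
rewrite -[z]reprK Dclass_le; apply/asboolP/ess_gen_sub.
have [_ satA _] := GA.
apply: (saturation_least hC (saturation_closed hC _)) satA => B [x [/zE xz [m mm]]].
apply: saturation_sub mm _; apply/ess_gen_sub.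
exact/asboolP.
Qed.

End CentralSupport.

Section Transport.
Variables (R : pzRingType) (d : Order.disp_t) (T : porderType d).
Implicit Types (x y z : T) (b c : Blat R).

Lemma central_idempotent1 : central_idempotent (1 : R).
Proof.
apply/andP; split; first by rewrite mulr1.
by apply/asboolP => y; rewrite /GRing.comm mulr1 mul1r.
Qed.

Definition Btop : Blat R := CentralIdempotent central_idempotent1.

Lemma Ble_top b : (b <= Btop)%O.
Proof. by rewrite Ble_def mulr1. Qed.

Lemma Bbot_le b : (Bcompl Btop <= b)%O.
Proof. by rewrite Ble_def /= subrr mul0r. Qed.

Lemma Bmeet_compl b : (b `&` Bcompl b)%O = Bcompl Btop.
Proof. by apply: val_inj; rewrite /= mulrBr mulr1 Bval_idem !subrr. Qed.

Lemma Bjoin_compl b : (b `|` Bcompl b)%O = Btop.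
Proof.
apply: val_inj; rewrite /= mulrBr mulr1 Bval_idem subrr subr0.
by rewrite addrC subrK.
Qed.

Lemma complete_boolean_transport (f : T -> Blat R) :
  {mono f : x y / (x <= y)%O} -> (forall c, exists x, f x = c) ->
  (forall A : set T, supremums A !=set0)%classic ->
  exists L : complete_boolean_lattice T,
    (forall x y, f (cb_join L x y) = (f x `|` f y)%O) /\
    (forall x y, f (cb_meet L x y) = (f x `&` f y)%O).
Proof.
move=> fle fsurj sups; pose g c := sval (cid (fsurj c)).
have gK c : f (g c) = c := svalP (cid (fsurj c)).
have finj : injective f.
  by move=> x y xy; apply/eqP; rewrite eq_le -!fle xy lexx.
unshelve eexists.
  apply: (@CompleteBooleanLattice d T (fun x y => g (f x `&` f y)%O)
    (fun x y => g (f x `|` f y)%O) (g (Bcompl Btop)) (g Btop)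
    (fun x => g (Bcompl (f x)))).
  - by move=> x y z; rewrite -fle gK lexI !fle.
  - by move=> x y z; rewrite -fle gK leUx !fle.
  - by move=> x; rewrite -fle gK Bbot_le.
  - by move=> x; rewrite -fle gK Ble_top.
  - by move=> x y z; rewrite !gK meetUr.
  - by move=> x; rewrite gK Bmeet_compl.
  - by move=> x; rewrite gK Bjoin_compl.
  - exact: sups.
  - move=> A; have [z [zub zleast]] := sups (lbound A).
    by exists z; split=> [x Ax|x xlb]; [apply: zleast => y; apply|apply: zub].
by split=> x y /=; rewrite gK.
Qed.

End Transport.

Theorem theorem4p5 (C : preadditive_category) (hC : grothendieck C)
    (X : C) (hX : injective_object X) :
  exists (L : complete_boolean_lattice (Dlat X))
         (f : Dlat X -> Blat (mod_jacobson (End X))),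
    [/\ bijective f,
        forall x y, f (cb_join L x y) = (f x `|` f y)%O,
        forall x y, f (cb_meet L x y) = (f x `&` f y)%O
      & forall (U : summand X) (p : mor X (summand_ob U)),
          p ∘ summand_inc U = 'id_(summand_ob U) ->
          let e := modJ (summand_inc U ∘ p : End X) in
          Bval (f (Dclass U)) * e = e /\
          forall c : Blat (mod_jacobson (End X)),
            Bval c * e = e -> (f (Dclass U) <= c)%O].
Proof.
pose f := Dlat_support hC hX.
have fsurj := Dlat_support_surj hC hX.
have [L [fjoin fmeet]] := complete_boolean_transport
  (Dlat_support_le hC hX) fsurj (Dlat_supremum hC hX).
exists L, f; split=> // [|U p pU e].
  pose g c := sval (cid (fsurj c)).
  have gK c : f (g c) = c := svalP (cid (fsurj c)).
  by exists g => // x; apply: (Dlat_support_inj (hC := hC) (injX := hX)).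
rewrite /f Dlat_support_class; split.
  by apply/(central_supportP hC hX U pU)/(ess_gen_sub hC).
by move=> c; apply: (central_support_le hC hX pU).
Qed.
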